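(* Let $H$ be a complex Hilbert space and let $\lambda\in[0,1]$. For every $T\in\mathcal{B}(H)$, $$r(T)=\inf\{\|\Delta_\lambda(XTX^{-1})\| : X\in\mathcal{B}(H)\text{ invertible}\}=\inf\{\|\Delta_\lambda(e^{A}Te^{-A})\| : A\in\mathcal{B}(H)\text{ self-adjoint}\}.$$
   Context: $H$ is a (nonzero) complex Hilbert space, $\mathcal{B}(H)$ is the space of bounded linear operators on $H$ with the operator norm $\|\cdot\|$, and $r(T)$ is the spectral radius of $T$. For $T\in\mathcal{B}(H)$, $|T|=(T^*T)^{1/2}$ and $T=U|T|$ is the unique polar decomposition, with $U$ the partial isometry satisfying $\ker U=\ker T$. For $\lambda\in[0,1]$ the $\lambda$-Aluthge transform is $\Delta_\lambda(T)=|T|^{\lambda}U|T|^{1-\lambda}$, with the convention $|T|^0=I$, so that $\Delta_0(T)=U|T|=T$ and $\Delta_1(T)=|T|U$. *)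

(* Defs.v *)
From HB Require Import structures.
From mathcomp Require Import all_boot all_order all_algebra.
From mathcomp Require Import complex.
From mathcomp Require Import all_classical all_reals all_analysis.

Set Implicit Arguments.
Unset Strict Implicit.
Unset Printing Implicit Defensive.

Import Order.TTheory GRing.Theory Num.Theory.
Import numFieldTopology.Exports numFieldNormedType.Exports.

Local Open Scope classical_set_scope.
Local Open Scope ring_scope.
Local Open Scope complex_scope.

(* A norm over R[i] takes its values in R[i], on nonnegative reals;
   [rnorm] is the same number as an element of R. *)
Definition rnorm (R : realType) (V : normedZmodType R[i]) (v : V) : R :=
  complex.Re `|v|.

Section rnorm.
Context {R : realType} {V : normedZmodType R[i]}.
Implicit Types v w : V.

Lemma rnormE v : (rnorm v)%:C = `|v|.
Proof. by rewrite /rnorm RRe_real// normr_real. Qed.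

Lemma rnorm_ge0 v : 0 <= rnorm v.
Proof. by rewrite -lecR rnormE normr_ge0. Qed.

Lemma rnormD v w : rnorm (v + w) <= rnorm v + rnorm w.
Proof. by rewrite -lecR rmorphD/= !rnormE ler_normD. Qed.

Lemma rnorm0_eq0 v : rnorm v = 0 -> v = 0.
Proof. by move=> v0; apply/normr0_eq0; rewrite -rnormE v0. Qed.

Lemma rnorm0 : rnorm (0 : V) = 0.
Proof. by rewrite /rnorm normr0. Qed.

End rnorm.

Lemma rnormZ (R : realType) (V : normedModType R[i]) (a : R[i]) (v : V) :
  rnorm (a *: v) = rnorm a * rnorm v.
Proof. by apply: complexI; rewrite rmorphM/= !rnormE normrZ. Qed.

HB.mixin Record CompleteNormedModule_isHilbert (R : realType) H
    & CompleteNormedModule R[i] H := {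
  inner : {dot H for Num.conj} ;
  sqr_norm_inner : forall x : H, `|x| ^+ 2 = inner x x
}.

#[short(type="hilbertType")]
HB.structure Definition Hilbert (R : realType) :=
  {H of CompleteNormedModule R[i] H & CompleteNormedModule_isHilbert R H}.

HB.mixin Record Hilbert_isNonzero (R : realType) H & Hilbert R H := {
  hilbert_neq0 : exists x : H, x != 0
}.

#[short(type="nzHilbertType")]
HB.structure Definition NzHilbert (R : realType) :=
  {H of Hilbert R H & Hilbert_isNonzero R H}.

Section bounded_operators.
Context {R : realType} {H : nzHilbertType R}.

Definition bounded_linear : {pred H -> H} :=
  [pred f | `[< linear f /\ exists M : R, forall x, rnorm (f x) <= M * rnorm x >]].

Lemma bounded_linearP (f : H -> H) : reflect
  (linear f /\ exists M : R, forall x, rnorm (f x) <= M * rnorm x)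
  (f \in bounded_linear).
Proof. exact: asboolP. Qed.

Lemma bounded_linear_submod : submod_closed bounded_linear.
Proof.
split=> [|a f g /bounded_linearP[lf [M fM]] /bounded_linearP[lg [N gN]]].
  apply/bounded_linearP; split=> [b x y|]; first by rewrite scaler0 addr0.
  by exists 0 => x; rewrite rnorm0 mul0r.
apply/bounded_linearP; split=> [b x y|].
  rewrite -[LHS]/(a *: f (b *: x + y) + g (b *: x + y)).
  rewrite -[RHS]/(b *: (a *: f x + g x) + (a *: f y + g y)).
  by rewrite lf lg !scalerDr addrACA !scalerA mulrC.
exists (rnorm a * M + N) => x; rewrite (le_trans (rnormD _ _))//.
by rewrite mulrDl lerD// rnormZ -mulrA ler_wpM2l ?rnorm_ge0.
Qed.

HB.instance Definition _ :=
  GRing.isSubmodClosed.Build R[i] (H -> H) bounded_linear bounded_linear_submod.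

Lemma bounded_linear_id : @id H \in bounded_linear.
Proof. by apply/bounded_linearP; split=> //; exists 1 => x; rewrite mul1r. Qed.

Lemma bounded_linear_comp (f g : H -> H) :
  f \in bounded_linear -> g \in bounded_linear -> f \o g \in bounded_linear.
Proof.
move=> /bounded_linearP[lf [M fM]] /bounded_linearP[lg [N gN]].
apply/bounded_linearP; split=> [a x y /=|]; first by rewrite lg lf.
exists (`|M| * N) => x /=; rewrite (le_trans (fM _))// -mulrA.
rewrite (@le_trans _ _ (`|M| * rnorm (g x)))//.
  by rewrite ler_wpM2r ?rnorm_ge0 ?ler_norm.
by rewrite ler_wpM2l.
Qed.

End bounded_operators.

Record bop (R : realType) (H : nzHilbertType R) := Bop {
  bop_fun :> H -> H ;
  bop_bounded_linear : bop_fun \in bounded_linear }.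
Arguments Bop {R H bop_fun}.

HB.instance Definition _ (R : realType) (H : nzHilbertType R) :=
  [isSub of bop H for @bop_fun R H].
HB.instance Definition _ (R : realType) (H : nzHilbertType R) :=
  [Choice of bop H by <:].
HB.instance Definition _ (R : realType) (H : nzHilbertType R) :=
  [SubChoice_isSubLmodule of bop H by <:].

Section bop_algebra.
Context {R : realType} {H : nzHilbertType R}.
Implicit Types (S T : bop H) (x y : H) (a : R[i]).

Lemma bop_ext S T : (forall x, S x = T x) -> S = T.
Proof. by move=> ST; apply/val_inj/funext. Qed.

Lemma bop_linear T : linear T.
Proof. by case/bounded_linearP: (bop_bounded_linear T). Qed.

HB.instance Definition _ T :=
  GRing.isLinear.Build R[i] H H _ (bop_fun T) (bop_linear T).

Lemma bop_bounded T : exists M : R, forall x, rnorm (T x) <= M * rnorm x.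
Proof. by case/bounded_linearP: (bop_bounded_linear T). Qed.

Definition bop1 : bop H := Bop bounded_linear_id.

Definition bop_comp S T : bop H :=
  Bop (bounded_linear_comp (bop_bounded_linear S) (bop_bounded_linear T)).

Lemma bop_compA : associative bop_comp.
Proof. by move=> S T U; apply: bop_ext. Qed.

Lemma bop_comp1l : left_id bop1 bop_comp.
Proof. by move=> S; apply: bop_ext. Qed.

Lemma bop_comp1r : right_id bop1 bop_comp.
Proof. by move=> S; apply: bop_ext. Qed.

Lemma bop_compDl : left_distributive bop_comp +%R.
Proof. by move=> S T U; apply: bop_ext. Qed.

Lemma bop_compDr : right_distributive bop_comp +%R.
Proof.
move=> S T U; apply: bop_ext => x.
by rewrite -[LHS]/(S (T x + U x)) raddfD.
Qed.

Lemma bop1_neq0 : bop1 != 0.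
Proof.
have [x x0] := @hilbert_neq0 R H.
by apply: contra_neq x0 => /(congr1 (fun T : bop H => T x)).
Qed.

HB.instance Definition _ := GRing.Zmodule_isNzRing.Build (bop H)
  bop_compA bop_comp1l bop_comp1r bop_compDl bop_compDr bop1_neq0.

Lemma bop_scalerAl a S T : a *: (S * T) = a *: S * T.
Proof. by apply: bop_ext. Qed.

HB.instance Definition _ :=
  GRing.Lmodule_isLalgebra.Build R[i] (bop H) bop_scalerAl.

Lemma bop_scalerAr a S T : a *: (S * T) = S * (a *: T).
Proof.
apply: bop_ext => x.
by rewrite -[RHS]/(S (a *: T x)) linearZ.
Qed.

HB.instance Definition _ :=
  GRing.Lalgebra_isAlgebra.Build R[i] (bop H) bop_scalerAr.

Definition bop_unit : {pred bop H} :=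
  [pred T | `[< exists S, S * T = 1 /\ T * S = 1 >]].

Definition bop_inv T : bop H := xget T [set S : bop H | S * T = 1 /\ T * S = 1].

Lemma bop_mulVr : {in bop_unit, left_inverse 1 bop_inv *%R}.
Proof.
by move=> T /asboolP[S ST]; rewrite /bop_inv; case: xgetP => [U _ []//|/(_ S)].
Qed.

Lemma bop_mulrV : {in bop_unit, right_inverse 1 bop_inv *%R}.
Proof.
by move=> T /asboolP[S ST]; rewrite /bop_inv; case: xgetP => [U _ []//|/(_ S)].
Qed.

Lemma bop_unitP S T : T * S = 1 /\ S * T = 1 -> S \in bop_unit.
Proof. by move=> ST; apply/asboolP; exists T. Qed.

Lemma bop_inv_out : {in [predC bop_unit], bop_inv =1 id}.
Proof.
move=> T /asboolP nT; rewrite /bop_inv; case: xgetP => [S _ ST|//].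
by case: nT; exists S.
Qed.

HB.instance Definition _ := GRing.NzRing_hasMulInverse.Build (bop H)
  bop_mulVr bop_mulrV bop_unitP bop_inv_out.

Definition opnorm T : R := sup [set rnorm (T x) | x in [set x | rnorm x <= 1]].

Lemma opnorm_has_sup T :
  has_sup [set rnorm (T x) | x in [set x | rnorm x <= 1]].
Proof.
split; first by exists (rnorm (T 0)), 0 => //=; rewrite rnorm0.
have [M TM] := bop_bounded T; exists `|M| => _ [x /= x1 <-].
rewrite (le_trans (TM x))// (@le_trans _ _ (`|M| * rnorm x))//.
  by rewrite ler_wpM2r ?rnorm_ge0 ?ler_norm.
by rewrite ler_piMr.
Qed.

Lemma opnorm_ge0 T : 0 <= opnorm T.
Proof.
apply: le_trans (rnorm_ge0 (T 0)) _; apply: ub_le_sup.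
  by case: (opnorm_has_sup T).
by exists 0 => //=; rewrite rnorm0.
Qed.

Lemma rnorm_opnorm T x : rnorm (T x) <= opnorm T * rnorm x.
Proof.
have [->|x0] := eqVneq x 0; first by rewrite raddf0 !rnorm0 mulr0.
have nx0 : 0 < rnorm x.
  by rewrite lt_neqAle rnorm_ge0 andbT eq_sym; apply: contra_neq x0 => /rnorm0_eq0.
have nV : rnorm ((rnorm x)^-1%:C) = (rnorm x)^-1.
  by rewrite /rnorm normc_def/= expr0n/= addr0 sqrtr_sqr ger0_norm// invr_ge0 ltW.
rewrite -ler_pdivrMr// mulrC -[X in X * _]nV -rnormZ -linearZ.
apply: ub_le_sup; first by case: (opnorm_has_sup T).
by exists ((rnorm x)^-1%:C *: x) => //=; rewrite rnormZ nV mulVf// gt_eqF.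
Qed.

Lemma opnorm_le T (M : R) : 0 <= M ->
  (forall x, rnorm (T x) <= M * rnorm x) -> opnorm T <= M.
Proof.
move=> M0 TM; apply: ge_sup; first by case: (opnorm_has_sup T).
by move=> _ [x /= x1 <-]; rewrite (le_trans (TM x))// ler_piMr.
Qed.

Lemma opnormD S T : opnorm (S + T) <= opnorm S + opnorm T.
Proof.
apply: opnorm_le => [|x]; first by rewrite addr_ge0 ?opnorm_ge0.
by rewrite mulrDl (le_trans (rnormD (S x) (T x)))// lerD ?rnorm_opnorm.
Qed.

Lemma opnormZ a T : opnorm (a *: T) = rnorm a * opnorm T.
Proof.
have le b U : opnorm (b *: U) <= rnorm b * opnorm U.
  apply: opnorm_le => [|x]; first by rewrite mulr_ge0 ?rnorm_ge0 ?opnorm_ge0.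
  rewrite -[bop_fun _ x]/(b *: U x) rnormZ -mulrA.
  by rewrite ler_wpM2l ?rnorm_ge0 ?rnorm_opnorm.
have [->|a0] := eqVneq a 0.
  rewrite rnorm0 mul0r; apply/le_anti; rewrite opnorm_ge0 andbT.
  by rewrite (le_trans (le 0 T))// rnorm0 mul0r.
apply/le_anti; rewrite le/=.
have a0' : 0 < rnorm a.
  by rewrite lt_neqAle rnorm_ge0 andbT eq_sym; apply: contra_neq a0 => /rnorm0_eq0.
have rVa : rnorm a * rnorm a^-1 = 1.
  by apply: complexI; rewrite rmorphM/= !rnormE -normrM divff// normr1.
have := le a^-1 (a *: T); rewrite scalerA mulVf// scale1r -(ler_pM2l a0').
by rewrite mulrA rVa mul1r.
Qed.

Lemma opnorm_eq0 T : opnorm T = 0 -> T = 0.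
Proof.
move=> T0; apply: bop_ext => x; apply: rnorm0_eq0; apply/le_anti.
by rewrite rnorm_ge0 andbT (le_trans (rnorm_opnorm T x))// T0 mul0r.
Qed.

Let norm T : R[i] := (opnorm T)%:C.

Let norm_triangle S T : norm (S + T) <= norm S + norm T.
Proof. by rewrite /norm -rmorphD lecR opnormD. Qed.

Let normZ a T : norm (a *: T) = `|a| * norm T.
Proof. by rewrite /norm opnormZ rmorphM/= rnormE. Qed.

Let norm0_eq0 T : norm T = 0 -> T = 0.
Proof. by case=> /opnorm_eq0. Qed.

HB.instance Definition _ := @Lmodule_isNormed.Build R[i] (bop H)
  norm norm_triangle normZ norm0_eq0.

Lemma rnorm_bopE T : rnorm T = opnorm T.
Proof. by []. Qed.

End bop_algebra.

Section operator_theory.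
Context {R : realType} {H : nzHilbertType R}.
Implicit Types (S T U A : bop H) (x y : H).

Definition spectrum T : set R[i] := [set z | T - z%:A \isn't a GRing.unit].

Definition spectral_radius T : R := sup [set rnorm z | z in spectrum T].

(* In the descriptions by [xget 0] below the default value 0 plays no role:
   the adjoint, the powers of a positive operator and the polar factor exist
   and are unique. *)
Definition adjoint T : bop H :=
  xget 0 [set S : bop H | forall x y, inner (T x) y = inner x (S y)].

Definition self_adjoint T := adjoint T = T.

(* B is f(S) in the continuous functional calculus of the self-adjoint S: the
   limit in norm of p(S) for real polynomials p tending to f uniformly on the
   (real) spectrum of S. *)
Definition is_functional_calculus (f : R -> R) S (B : bop H) :=
  forall e : R, 0 < e -> exists p : {poly R},
    (forall t : R, spectrum S t%:C -> `|p.[t] - f t| <= e) /\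
    opnorm (horner_alg S (map_poly (real_complex R) p) - B) <= e.

(* t `^ 0 = 1 for every t, including t = 0, so the power 0 is the identity. *)
Definition op_pow S (r : R) : bop H :=
  xget 0 [set B : bop H | is_functional_calculus (fun t => t `^ r) S B].

Definition op_abs T : bop H := op_pow (adjoint T * T) 2^-1.

Definition partial_isometry U := forall x,
  (forall y, U y = 0 -> inner x y = 0) -> `|U x| = `|x|.

Definition polar T : bop H := xget 0 [set U : bop H |
  [/\ partial_isometry U, (forall x, U x = 0 <-> T x = 0) & T = U * op_abs T]].

Definition aluthge (lambda : R) T : bop H :=
  op_pow (op_abs T) lambda * polar T * op_pow (op_abs T) (1 - lambda).

(* The limit is taken in operator norm, which is the norm of [bop H]. *)
Definition op_exp A : bop H :=
  limn (series (fun n => (n`!%:R : R[i])^-1 *: A ^+ n)).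

End operator_theory.

(* Main.v *)
(* The spectral radius r(T) bounds |Delta_lambda(X T X^-1)| from below:
   Delta_lambda(S) = |S|^lambda (U |S|^(1-lambda)) and S = U |S| =
   (U |S|^(1-lambda)) |S|^lambda are products of the same two factors, so they
   have the same spectral radius.

   For the converse, |Delta_lambda(S)| <= |S|, so it suffices to find for every
   s > r(T) a self-adjoint A with |e^A T e^(-A)| <= s.  The spectral radius
   formula yields n with |T^n| <= s^n; then P = sum_(k < n) s^(-2k) (T^k)^* T^k
   satisfies P >= 1 and T^* P T <= s^2 P, and A = ln P / 2 works. The inequality
   |T^n| <= s^n is obtained by real methods: (1 - (uT)^(2^k))^-1 is an average
   of resolvents of T, hence Lipschitz in u uniformly in k, which propagates the
   decay of (uT)^(2^k) from u = 0 to all |u| < 1 / r(T). *)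
Require Import Defs.
From mathcomp Require Import all_boot all_order all_algebra.
From mathcomp Require Import complex.
From mathcomp Require Import all_classical all_reals all_analysis.
From mathcomp Require Import ring lra.
Set Implicit Arguments.
Unset Strict Implicit.
Unset Printing Implicit Defensive.
Import Order.TTheory GRing.Theory Num.Theory.
Import numFieldTopology.Exports numFieldNormedType.Exports.
Local Open Scope classical_set_scope.
Local Open Scope ring_scope.
Local Open Scope complex_scope.

(** * Inner products *)

(** The functional calculus behind the powers and exponentials rests on one fact: for a self-adjoint
    [S] and a real polynomial [p], the norm of [p(S)] is the value of [|p|] at some point of the
    spectrum. An elementary estimate puts [|N|^2] in the spectrum of [N^2] for self-adjoint [N]; for
    [N = p(S)], factorization over [R[i]] yields the point. Existence of [f(S)] then reduces to
    uniform polynomial approximation of [f] on an interval.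

    In the bound on powers, a small [(uT)^(2^k)] cannot be followed directly from one [u] to the
    next uniformly in [k]. The inverse of [1 - (uT)^(2^k)] can be, and it is close to [1] when the
    power is small. A step of fixed length only yields a power of norm at most [1]; shrinking [u]
    slightly and increasing [k] restores the smallness. With exponents [2^k], each average needs
    only two terms, and the roots of [-1] come from iterated square roots.

    The same [A] serves both infima, since [e^A] is a particular invertible operator with inverse
    [e^(-A)]. *)

Section rnorm_theory.
Context {R : realType}.

Lemma rnormC (c : R) : rnorm (c%:C : R[i]) = `|c|.
Proof. by rewrite /rnorm normc_def/= expr0n/= addr0 sqrtr_sqr. Qed.

Lemma rnormM (a b : R[i]) : rnorm (a * b) = rnorm a * rnorm b.
Proof. by apply: complexI; rewrite rmorphM/= !rnormE normrM. Qed.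

Lemma rnorm_conj (a : R[i]) : rnorm (a^*%C) = rnorm a.
Proof. by rewrite /rnorm !normc_def; case: a => u v /=; rewrite sqrrN. Qed.

Context {V : normedZmodType R[i]}.
Implicit Types x y z : V.

Lemma rnormN x : rnorm (- x) = rnorm x.
Proof. by rewrite /rnorm normrN. Qed.

Lemma rnormBC x y : rnorm (x - y) = rnorm (y - x).
Proof. by rewrite -rnormN opprB. Qed.

Lemma rnorm_triangle z x y : rnorm (x - y) <= rnorm (x - z) + rnorm (z - y).
Proof. by rewrite (le_trans _ (rnormD _ _))// addrA subrK. Qed.

Lemma rnormB_ge x y : rnorm x - rnorm y <= rnorm (x - y).
Proof. by rewrite lerBlDr (le_trans _ (rnormD _ _))// subrK. Qed.

End rnorm_theory.

Lemma rnormZR (R : realType) (V : normedModType R[i]) (c : R) (x : V) :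
  rnorm (c%:C *: x) = `|c| * rnorm x.
Proof. by rewrite rnormZ rnormC. Qed.

Section real_inner_product.
Context {R : realType} {H : hilbertType R}.
Implicit Types (x y z : H) (a : R[i]) (c : R).

Definition rdot x y : R := complex.Re (inner x y).

Lemma innerDl x y z : inner (x + y) z = inner x z + inner y z.
Proof. exact: linearDl. Qed.

Lemma innerBl x y z : inner (x - y) z = inner x z - inner y z.
Proof. exact: linearBl. Qed.

Lemma innerDr x y z : inner x (y + z) = inner x y + inner x z.
Proof. exact: linearDr. Qed.

Lemma innerBr x y z : inner x (y - z) = inner x y - inner x z.
Proof. exact: linearBr. Qed.

Lemma inner0l x : inner 0 x = 0.
Proof. exact: linear0l. Qed.

Lemma inner0r x : inner x 0 = 0.
Proof. exact: linear0r. Qed.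

Lemma rdotDl x y z : rdot (x + y) z = rdot x z + rdot y z.
Proof. by rewrite /rdot innerDl raddfD. Qed.

Lemma rdotDr x y z : rdot x (y + z) = rdot x y + rdot x z.
Proof. by rewrite /rdot innerDr raddfD. Qed.

Lemma innerC x y : inner x y = (inner y x)^*%C.
Proof. by rewrite (hermC inner) expr0 mul1r. Qed.

Lemma innerZl a x y : inner (a *: x) y = a * inner x y.
Proof. by rewrite linearZl_LR. Qed.

Lemma innerZr a x y : inner x (a *: y) = (a^*)%C * inner x y.
Proof. by rewrite linearZr_LR. Qed.

Lemma rdotC x y : rdot x y = rdot y x.
Proof. by rewrite /rdot innerC; case: (inner y x). Qed.

Lemma rdotZl c x y : rdot (c%:C *: x) y = c * rdot x y.
Proof. by rewrite /rdot innerZl; case: (inner x y) => u v /=;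
  rewrite mul0r subr0. Qed.

Lemma rdotZr c x y : rdot x (c%:C *: y) = c * rdot x y.
Proof. by rewrite rdotC rdotZl rdotC. Qed.

Lemma rdotNl x y : rdot (- x) y = - rdot x y.
Proof. by rewrite /rdot linearNl raddfN. Qed.

Lemma rdotNr x y : rdot x (- y) = - rdot x y.
Proof. by rewrite rdotC rdotNl rdotC. Qed.

Lemma rdotBl x y z : rdot (x - y) z = rdot x z - rdot y z.
Proof. by rewrite rdotDl rdotNl. Qed.

Lemma rdotBr x y z : rdot x (y - z) = rdot x y - rdot x z.
Proof. by rewrite rdotDr rdotNr. Qed.

Lemma rdotxx x : rdot x x = rnorm x ^+ 2.
Proof.
apply: complexI; rewrite rmorphXn/= rnormE sqr_norm_inner /rdot RRe_real//.
by rewrite -sqr_norm_inner realX// normr_real.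
Qed.

(** Conjugate-linearity gives [inner x ('i *: y) = - 'i * inner x y], whose real part is the
    imaginary part of [inner x y]. Orthogonality to a complex subspace thus reduces to the real form
    [rdot]. *)
Lemma inner_rdot x y : inner x y = (rdot x y +i* rdot x ('i%C *: y))%C.
Proof.
rewrite /rdot innerZr; case: (inner x y) => u v /=.
by rewrite mul0r mulN1r opprK add0r.
Qed.

Lemma rnormD_sqr x y :
  rnorm (x + y) ^+ 2 = rnorm x ^+ 2 + 2 * rdot x y + rnorm y ^+ 2.
Proof. by rewrite -!rdotxx rdotDl !rdotDr (rdotC y x); ring. Qed.

Lemma rnormB_sqr x y :
  rnorm (x - y) ^+ 2 = rnorm x ^+ 2 - 2 * rdot x y + rnorm y ^+ 2.
Proof. by rewrite rnormD_sqr rnormN rdotNr; ring. Qed.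

Lemma rdot_le x y : rdot x y <= rnorm x * rnorm y.
Proof.
have [->|x0] := eqVneq x 0; first by rewrite /rdot inner0l rnorm0 mul0r.
have nx0 : 0 < rnorm x.
  by rewrite lt_neqAle rnorm_ge0 andbT eq_sym;
    apply: contra_neq x0 => /rnorm0_eq0.
have := sqr_ge0 (rnorm ((rnorm x)%:C *: y - (rnorm y)%:C *: x)).
rewrite rnormB_sqr !rnormZR !ger0_norm ?rnorm_ge0// rdotZl rdotZr (rdotC y x).
move=> h; have [y0|y0] := eqVneq y 0;
  first by rewrite y0 rdotC /rdot inner0l rnorm0 mulr0.
have ny0 : 0 < rnorm y.
  by rewrite lt_neqAle rnorm_ge0 andbT eq_sym;
    apply: contra_neq y0 => /rnorm0_eq0.
have xy0 := mulr_gt0 nx0 ny0; rewrite -(ler_pM2l xy0).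
by nra.
Qed.

Lemma rdot_eq0 x : (forall y, rdot x y = 0) -> x = 0.
Proof.
move=> x0; apply: rnorm0_eq0; apply/eqP.
by rewrite -sqrf_eq0 -rdotxx x0.
Qed.

Lemma rnorm_complete (u : nat -> H) :
  (forall e : R, 0 < e -> exists N, forall m n, (N <= m)%N -> (N <= n)%N ->
     rnorm (u m - u n) <= e) ->
  exists l, forall e : R, 0 < e -> exists N, forall n, (N <= n)%N ->
     rnorm (u n - l) <= e.
Proof.
move=> cu.
have /cauchy_cvg/cvg_ex[l /cvg_ballP ul] : cauchy (u @ \oo).
  apply/cauchy_ballP => e e0.
  have [e' e'0 ->] : exists2 e' : R, 0 < e' & e = e'%:C.
    exists (complex.Re e); last by rewrite RRe_real// gtr0_real.
    by rewrite -ltcR RRe_real// gtr0_real.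
  have [|N uN] := cu (e' / 2); first by rewrite divr_gt0.
  rewrite near_map2; near=> m n => /=.
  rewrite -ball_normE /= -rnormE ltcR.
  apply: le_lt_trans (uN _ _ _ _) _; [near: m|near: n|lra];
    exact: nbhs_infty_ge.
exists l => e e0.
have /ul[N _ uN] : (0 : R[i]) < e%:C by rewrite ltcR.
exists N => n Nn; have := uN n Nn.
by rewrite -ball_normE /= -rnormE ltcR rnormBC => /ltW.
Unshelve. all: by end_near. Qed.

End real_inner_product.

(** * Projections and adjoints *)

Section projection.
Context {R : realType} {H : hilbertType R}.
Implicit Types (x y z : H) (M : set H).

Lemma norm_rdot_le x y : `|rdot x y| <= rnorm x * rnorm y.
Proof. by rewrite ler_norml lerNl -rdotNl -{1}(rnormN x) !rdot_le. Qed.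

Lemma small_eq0 (r K : R) : (forall e, 0 < e -> `|r| <= e * K) -> r = 0.
Proof.
move=> h; apply/eqP; rewrite -normr_le0 leNgt; apply/negP => r0.
have K0 : 0 < K by have := lt_le_trans r0 (h 1 ltr01); rewrite mul1r.
have := h (`|r| / K / 2); rewrite !divr_gt0// => /(_ isT).
rewrite mulrAC divfK ?gt_eqF//; lra.
Qed.

Definition closed_subspace M :=
  [/\ M 0, (forall x y, M x -> M y -> M (x + y)),
      (forall a x, M x -> M (a *: x)) &
      forall x, (forall e : R, 0 < e -> exists2 y, M y & rnorm (x - y) <= e) ->
        M x].

Lemma closed_subspaceB M x y : closed_subspace M -> M x -> M y -> M (x - y).
Proof. by move=> [_ MD MZ _] Mx My; rewrite -scaleN1r; apply/MD/MZ. Qed.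

(** The optimal multiple of [y] to subtract is [r / k], but [k] vanishes for [y = 0]. The choice
    [r / (k + 1)] avoids this case and still lowers the squared norm by
    [(r / (k + 1)) ^+ 2 * (k + 2)]. *)
Lemma rdot0_of_minimal x y :
  (forall c : R, rnorm x <= rnorm (x - c%:C *: y)) -> rdot x y = 0.
Proof.
move=> h; set r := rdot x y; set k := rnorm y ^+ 2.
have k0 : 0 <= k by exact: sqr_ge0.
have := h (r / (k + 1)); rewrite -ler_sqr ?nnegrE ?rnorm_ge0//.
rewrite rnormB_sqr rdotZr rnormZR exprMn -normrX.
rewrite (ger0_norm (sqr_ge0 _)) -/r -/k.
have -> : rnorm x ^+ 2 - 2 * (r / (k + 1) * r) + (r / (k + 1)) ^+ 2 * k =
    rnorm x ^+ 2 - (r / (k + 1)) ^+ 2 * (k + 2).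
  by field; rewrite gt_eqF// ltr_wpDl.
have s0 := sqr_ge0 (r / (k + 1)) => h'.
have /eqP : (r / (k + 1)) ^+ 2 = 0 by nra.
by rewrite sqrf_eq0 mulf_eq0 invr_eq0 (gt_eqF (ltr_wpDl k0 _))// orbF => /eqP.
Qed.

Lemma projection_theorem M x : closed_subspace M ->
  exists2 p, M p & forall m, M m -> inner (x - p) m = 0.
Proof.
move=> cM; have [M0 MD MZ Mcl] := cM.
set D := [set rnorm (x - m) | m in M]; set d := inf D.
have D0 : D !=set0 by exists (rnorm (x - 0)), 0.
have Dlb : lbound D 0 by move=> _ [m _ <-]; exact: rnorm_ge0.
have hiD : has_inf D by split=> //; exists 0.
have d0 : 0 <= d by exact: lb_le_inf.
have dM m : M m -> d <= rnorm (x - m).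
  by move=> Mm; apply: ge_inf; [exists 0|exists m].
have near_inf (n : nat) : exists m, M m /\ rnorm (x - m) <= d + n.+1%:R^-1.
  have [|_ [m Mm <-] h] := @inf_adherent _ D n.+1%:R^-1 _ hiD.
    by rewrite invr_gt0.
  by exists m; split=> //; exact: ltW.
have [u uP] := choice near_inf.
have uM n : M (u n) by have [] := uP n.
(* From the index [Num.trunc h^-1] on, [n.+1%:R^-1 <= h], because [h^-1] is less than its truncation
   plus one. *)
have udist (h : R) n : 0 < h -> (Num.trunc h^-1 <= n)%N -> rnorm (x - u n) <= d
  + h.
  move=> h0 hn; have [_ /le_trans] := uP n; apply.
  rewrite lerD2l invf_ple ?posrE//.
  by rewrite ltW// (lt_le_trans (truncnS_gt _))// ler_nat.
have [|p up] := rnorm_complete (u := u).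
  (* The midpoint of [u m] and [u n] is at distance at least [d] from [x], so the parallelogram
     identity bounds [|u m - u n|^2] by [4 (d + h)^2 - 4 d^2 = 8 d h + 4 h^2]. For [h <= 1] this is
     at most [h (8 d + 4)]. *)
  move=> e e0; set h := Num.min 1 (e ^+ 2 / (8 * d + 4)).
  have dd : 0 < 8 * d + 4 by lra.
  have h0 : 0 < h by rewrite lt_min ltr01 divr_gt0// exprn_gt0.
  exists (Num.trunc h^-1) => m n hm hn.
  have a1 := udist h m h0 hm; have a2 := udist h n h0 hn.
  have a3 : d <= rnorm (x - (2^-1%:C) *: (u m + u n)) by exact/dM/MZ/MD.
  have h1 : h <= 1 by rewrite ge_min lexx.
  have h2 : h * (8 * d + 4) <= e ^+ 2 by rewrite -ler_pdivlMr// ge_min lexx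
    orbT.
  rewrite -ler_sqr ?nnegrE ?rnorm_ge0 ?(ltW e0)//.
  have par : rnorm (u m - u n) ^+ 2 = 2 * rnorm (x - u m) ^+ 2 +
      2 * rnorm (x - u n) ^+ 2 - 4 * rnorm (x - (2^-1%:C) *: (u m + u n)) ^+ 2.
    rewrite !rnormB_sqr rdotZr rnormZR exprMn rnormD_sqr rdotDr.
    by rewrite ger0_norm ?invr_ge0//; field.
  rewrite par; have g1 := rnorm_ge0 (x - u m); have g2 := rnorm_ge0 (x - u n).
  have b1 : rnorm (x - u m) ^+ 2 <= (d + h) ^+ 2 by rewrite ler_sqr ?nnegrE;
    lra.
  have b2 : rnorm (x - u n) ^+ 2 <= (d + h) ^+ 2 by rewrite ler_sqr ?nnegrE;
    lra.
  have b3 : d ^+ 2 <= rnorm (x - (2^-1%:C) *: (u m + u n)) ^+ 2.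
    by rewrite ler_sqr ?nnegrE//; lra.
  have hh : h ^+ 2 <= h by rewrite expr2 ler_piMr// ltW.
  have dE : (d + h) ^+ 2 = d ^+ 2 + 2 * (d * h) + h ^+ 2 by ring.
  have hE : h * (8 * d + 4) = 8 * (d * h) + 4 * h by ring.
  lra.
have Mp : M p.
  apply: Mcl => e e0; have [N uN] := up e e0.
  by exists (u N) => //; rewrite rnormBC uN.
have pd : rnorm (x - p) <= d.
  apply/ler_addgt0Pr => e e0.
  have e20 : 0 < e / 2 by rewrite divr_gt0.
  have [N uN] := up _ e20.
  set n := maxn N (Num.trunc (e / 2)^-1).
  have a1 := uN n (leq_maxl _ _).
  have a2 := udist _ n e20 (leq_maxr _ _).
  have := rnorm_triangle (u n) x p; lra.
exists p => // m Mm.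
have o m' : M m' -> rdot (x - p) m' = 0.
  move=> Mm'; apply: rdot0_of_minimal => c.
  by rewrite (le_trans pd)// -addrA -opprD; apply/dM/MD/MZ.
by rewrite inner_rdot !o//; exact: MZ.
Qed.

End projection.

Section adjoint.
Context {R : realType} {H : nzHilbertType R}.
Implicit Types (S T U : bop H) (x y z : H).

Lemma bopD T x y : T (x + y) = T x + T y.
Proof. exact: linearD. Qed.

Lemma bopB T x y : T (x - y) = T x - T y.
Proof. exact: linearB. Qed.

Lemma bopZ T (a : R[i]) x : T (a *: x) = a *: T x.
Proof. exact: linearZ. Qed.

Lemma bop0 T : T 0 = 0.
Proof. exact: linear0. Qed.

(** Riesz representation of the functional [x |-> inner (T x) y]: either it vanishes, or a multiple
    of a vector [w] orthogonal to its kernel represents it. *)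
Lemma adjoint_vector_exists T y : exists z, forall x, inner (T x) y = inner x z.
Proof.
pose M : set H := [set x | inner (T x) y = 0].
have cM : closed_subspace M.
  split => [|u v Mu Mv|a u Mu|u h]; rewrite /M/=.
  - by rewrite bop0 inner0l.
  - by rewrite bopD innerDl Mu Mv addr0.
  - by rewrite bopZ innerZl Mu mulr0.
  have small y' : (forall m, inner (T m) y = 0 -> rdot (T m) y' = 0) ->
      rdot (T u) y' = 0.
    move=> hy'; apply: (@small_eq0 _ _ (opnorm T * rnorm y')) => e e0.
    have [m Mm um] := h e e0.
    rewrite -[rdot _ _]subr0 -(hy' m Mm) -rdotBl -bopB.
    rewrite (le_trans (norm_rdot_le _ _))// mulrA ler_wpM2r ?rnorm_ge0//.
    rewrite (le_trans (rnorm_opnorm _ _))// mulrC ler_wpM2r ?opnorm_ge0//.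
  rewrite inner_rdot !small// => m; rewrite /rdot.
    by rewrite innerZr => ->; rewrite mulr0.
  by move=> ->.
have [Mall|] := pselect (forall x, M x).
  by exists 0 => x; rewrite inner0r; exact: Mall.
move=> /existsNP[z0 nMz0]; have [p Mp op] := projection_theorem z0 cM.
set w := z0 - p in op.
have fw : inner (T w) y != 0.
  by rewrite /w bopB innerBl Mp subr0; apply/eqP.
have w0 : w != 0 by apply: contraNneq fw => ->; rewrite bop0 inner0l.
have ww : inner w w != 0.
  rewrite -sqr_norm_inner sqrf_eq0 normr_eq0//.
set f := inner (T w) y.
exists ((f / inner w w)^*%C *: w) => x.
(* The functional takes the same value on both terms, so their difference lies in the kernel and is
   orthogonal to [w]. *)
have : M (f *: x - inner (T x) y *: w).
  by rewrite /M/= bopB innerBl !bopZ !innerZl mulrC subrr.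
move=> /op; rewrite innerBr !innerZr => /eqP; rewrite subr_eq0 => /eqP h.
have := congr1 conjc h; rewrite !rmorphM/= !conjcK -!innerC => h'.
by rewrite mulrAC h' mulfK.
Qed.

Lemma adjoint_exists T : exists S, forall x y, inner (T x) y = inner x (S y).
Proof.
have [f fP] := choice (adjoint_vector_exists T).
have uniq u v : (forall x, inner x u = inner x v) -> u = v.
  move=> h; apply/eqP; rewrite -subr_eq0; apply/eqP/rdot_eq0 => x.
  by rewrite rdotC /rdot innerBr h subrr.
have fb : f \in bounded_linear.
  apply/bounded_linearP; split.
    move=> a u v; apply: uniq => x.
    by rewrite -fP !innerDr !innerZr -!fP.
  exists (opnorm T) => y.
  have [->|f0] := eqVneq (f y) 0.
    by rewrite rnorm0 mulr_ge0 ?opnorm_ge0 ?rnorm_ge0.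
  have nf : 0 < rnorm (f y).
    rewrite lt_neqAle rnorm_ge0 andbT eq_sym.
    by apply: contra_neq f0 => /rnorm0_eq0.
  rewrite -(ler_pM2l nf) -expr2 -rdotxx /rdot -fP.
  rewrite (le_trans (rdot_le _ _))// mulrA ler_wpM2r ?rnorm_ge0// mulrC.
  exact: rnorm_opnorm.
by exists (Bop fb) => x y; rewrite fP.
Qed.

Lemma adjointP T x y : inner (T x) y = inner x (adjoint T y).
Proof. by rewrite /adjoint; case: xgetP => [S _ ->//|];
  have [S SP /(_ S)] := adjoint_exists T. Qed.

Lemma adjointPr T x y : inner x (T y) = inner (adjoint T x) y.
Proof. by rewrite innerC adjointP -innerC. Qed.

Lemma rdot_adjoint T x y : rdot (T x) y = rdot x (adjoint T y).
Proof. by rewrite /rdot adjointP. Qed.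

Lemma rdot_adjointr T x y : rdot x (T y) = rdot (adjoint T x) y.
Proof. by rewrite /rdot adjointPr. Qed.

Lemma bop_rdot_ext S T : (forall x y, rdot (S x) y = rdot (T x) y) -> S = T.
Proof.
move=> h; apply: bop_ext => x; apply/eqP; rewrite -subr_eq0; apply/eqP.
by apply: rdot_eq0 => y; rewrite rdotBl h subrr.
Qed.

Lemma adjointK : involutive (@adjoint R H).
Proof. by move=> T; apply: bop_rdot_ext => x y;
  rewrite -rdot_adjointr -rdot_adjoint. Qed.

Lemma adjointD S T : adjoint (S + T) = adjoint S + adjoint T.
Proof.
apply: bop_rdot_ext => x y.
rewrite -rdot_adjointr -[(S + T) y]/(S y + T y).
by rewrite -[(adjoint S + _) x]/(adjoint S x + adjoint T x) rdotDl rdotDr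
  !rdot_adjointr.
Qed.

Lemma adjointM S T : adjoint (S * T) = adjoint T * adjoint S.
Proof.
apply: bop_rdot_ext => x y.
by rewrite -rdot_adjointr -[(S * T) y]/(S (T y)) 2!rdot_adjointr.
Qed.

Lemma adjoint1 : adjoint 1 = 1 :> bop H.
Proof. by apply: bop_rdot_ext => x y; rewrite -rdot_adjointr. Qed.

Lemma adjointZ a T : adjoint (a *: T) = (a^*)%C *: adjoint T.
Proof.
apply: bop_rdot_ext => x y.
rewrite -rdot_adjointr -[(a *: T) y]/(a *: T y).
rewrite -[(_ *: adjoint T) x]/(_ *: adjoint T x) /rdot innerZr innerZl.
by rewrite adjointPr.
Qed.

Lemma adjointN T : adjoint (- T) = - adjoint T.
Proof.
apply: bop_rdot_ext => x y.
rewrite -rdot_adjointr -[(- T) y]/(- T y) -[(- adjoint T) x]/(- adjoint T x).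
by rewrite rdotNl rdotNr rdot_adjointr.
Qed.

Lemma opnorm_adjoint_le T : opnorm (adjoint T) <= opnorm T.
Proof.
apply: opnorm_le => [|y]; first exact: opnorm_ge0.
have [->|f0] := eqVneq (adjoint T y) 0.
  by rewrite rnorm0 mulr_ge0 ?opnorm_ge0 ?rnorm_ge0.
have nf : 0 < rnorm (adjoint T y).
  rewrite lt_neqAle rnorm_ge0 andbT eq_sym.
  by apply: contra_neq f0 => /rnorm0_eq0.
rewrite -(ler_pM2l nf) -expr2 -rdotxx -rdot_adjoint.
rewrite (le_trans (rdot_le _ _))// mulrA ler_wpM2r ?rnorm_ge0// mulrC.
exact: rnorm_opnorm.
Qed.

Lemma opnorm_adjoint T : opnorm (adjoint T) = opnorm T.
Proof.
by apply/le_anti; rewrite opnorm_adjoint_le/= -{1}(adjointK T)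
  opnorm_adjoint_le.
Qed.

End adjoint.

(** * Invertibility and the spectrum *)

Section invertibility.
Context {R : realType} {H : nzHilbertType R}.
Implicit Types (S T U V : bop H) (x y z : H) (a : R[i]).

Lemma opnormM S T : opnorm (S * T) <= opnorm S * opnorm T.
Proof.
apply: opnorm_le => [|x]; first by rewrite mulr_ge0 ?opnorm_ge0.
rewrite -[(S * T) x]/(S (T x)) (le_trans (rnorm_opnorm _ _))// -mulrA.
by rewrite ler_wpM2l ?opnorm_ge0 ?rnorm_opnorm.
Qed.

Lemma opnorm1_le : opnorm (1 : bop H) <= 1.
Proof. by apply: opnorm_le => // x; rewrite mul1r. Qed.

Lemma opnormX_le T n : opnorm (T ^+ n) <= opnorm T ^+ n.
Proof.
elim: n => [|n IH]; first by rewrite !expr0 opnorm1_le.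
by rewrite !exprS (le_trans (opnormM _ _))// ler_wpM2l ?opnorm_ge0.
Qed.

Lemma opnormN T : opnorm (- T) = opnorm T.
Proof. by rewrite -!rnorm_bopE rnormN. Qed.

Lemma opnorm0 : opnorm (0 : bop H) = 0.
Proof. by rewrite -rnorm_bopE rnorm0. Qed.

Lemma opnormBC S T : opnorm (S - T) = opnorm (T - S).
Proof. by rewrite -opnormN opprB. Qed.

Lemma opnorm_triangle T S U : opnorm (S - U) <= opnorm (S - T) + opnorm (T - U).
Proof. by rewrite (le_trans _ (opnormD _ _))// addrA subrK. Qed.

Lemma opnormZR (c : R) T : opnorm (c%:C *: T) = `|c| * opnorm T.
Proof. by rewrite opnormZ rnormC. Qed.

(** The lower bound makes [T] injective with closed range, and a vector orthogonal to the range is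
    killed by the adjoint, so the range is all of [H]. This criterion takes the place of the Neumann
    series in bounding the spectrum by the norm. *)
Lemma bop_unit_bounded_below T (c : R) : 0 < c ->
  (forall x, c * rnorm x <= rnorm (T x)) ->
  (forall x, adjoint T x = 0 -> x = 0) -> T \is a GRing.unit.
Proof.
move=> c0 Tc Ti.
pose M : set H := [set T x | x in setT].
have cM : closed_subspace M.
  split => [|_ _ [u _ <-] [v _ <-]|a _ [u _ <-]|x h].
  - by exists 0; rewrite ?bop0.
  - by exists (u + v); rewrite ?bopD.
  - by exists (a *: u); rewrite ?bopZ.
  have h' (n : nat) : exists y, rnorm (x - T y) <= n.+1%:R^-1.
    by have [|_ [y _ <-] ?] := h n.+1%:R^-1; [rewrite invr_gt0|exists y].
  have [u uP] := choice h'.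
  have ud (e : R) n : 0 < e -> (Num.trunc e^-1 <= n)%N -> rnorm (x - T (u n))
    <= e.
    move=> e0 hn; rewrite (le_trans (uP n))// invf_ple ?posrE//.
    by rewrite ltW// (lt_le_trans (truncnS_gt _))// ler_nat.
  have [|y uy] := rnorm_complete (u := u).
    move=> e e0; have e'0 : 0 < c * e / 2 by rewrite divr_gt0 ?mulr_gt0.
    exists (Num.trunc (c * e / 2)^-1) => m n hm hn.
    rewrite -(ler_pM2l c0) (le_trans (Tc _))// bopB.
    rewrite (le_trans (rnorm_triangle x _ _))// (rnormBC _ x).
    by have := ud _ _ e'0 hm; have := ud _ _ e'0 hn; lra.
  exists y => //; apply/eqP; rewrite -subr_eq0; apply/eqP/rnorm0_eq0.
  apply: (@small_eq0 _ _ (1 + opnorm T)) => e e0;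
    rewrite ger0_norm ?rnorm_ge0//.
  have [N uN] := uy e e0; pose n := maxn N (Num.trunc e^-1).
  have h1 := ud e n e0 (leq_maxr _ _); have h2 := uN n (leq_maxl _ _).
  rewrite rnormBC (le_trans (rnorm_triangle (T (u n)) _ _))// mulrDr mulr1
    lerD//.
  rewrite -bopB (le_trans (rnorm_opnorm _ _))// mulrC.
  by rewrite ler_wpM2r ?opnorm_ge0.
have surj x : exists y, T y = x.
  have [p [y _ <-] op] := projection_theorem x cM.
  exists y; apply/eqP; rewrite eq_sym -subr_eq0; apply/eqP/Ti.
  apply: rdot_eq0 => z; rewrite rdot_adjoint adjointK.
  by rewrite /rdot op//; exists z.
have [f fK] := choice surj.
have Tinj x y : T x = T y -> x = y.
  move=> xy; apply/eqP; rewrite -subr_eq0; apply/eqP/rnorm0_eq0/le_anti.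
  rewrite rnorm_ge0 andbT -(ler_pM2l c0) mulr0 (le_trans (Tc _))//.
  by rewrite bopB xy subrr rnorm0.
have fb : f \in bounded_linear.
  apply/bounded_linearP; split.
    by move=> a u v; apply: Tinj; rewrite bopD bopZ !fK.
  exists c^-1 => x; rewrite mulrC ler_pdivlMr// mulrC (le_trans (Tc _))//.
  by rewrite fK.
apply/unitrP; exists (Bop fb); split; apply: bop_ext => x; last exact: fK.
by apply: Tinj; exact: fK.
Qed.

Lemma bop_unit_bounded_below2 T (c : R) : 0 < c ->
  (forall x, c * rnorm x <= rnorm (T x)) ->
  (forall x, c * rnorm x <= rnorm (adjoint T x)) -> T \is a GRing.unit.
Proof.
move=> c0 Tc T'c; apply: (bop_unit_bounded_below c0 Tc) => x Tx0.
apply/rnorm0_eq0/le_anti; rewrite rnorm_ge0 andbT -(ler_pM2l c0) mulr0.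
by rewrite (le_trans (T'c _))// Tx0 rnorm0.
Qed.

Lemma rnorm_unit_le T x : T \is a GRing.unit ->
  rnorm x <= opnorm T^-1 * rnorm (T x).
Proof.
move=> uT; have -> : x = T^-1 (T x) by rewrite -[RHS]/((T^-1 * T) x) mulVr.
rewrite (le_trans (rnorm_opnorm _ _))//.
by rewrite -[T (T^-1 _)]/((T * T^-1) (T x)) mulrV.
Qed.

Lemma scalarAE a x : (a%:A : bop H) x = a *: x.
Proof. by []. Qed.

Lemma adjoint_scalar a : adjoint (a%:A : bop H) = (a^*)%C%:A.
Proof. by rewrite adjointZ adjoint1. Qed.

Lemma adjointB S T : adjoint (S - T) = adjoint S - adjoint T.
Proof. by rewrite adjointD adjointN. Qed.

Lemma bopBE S T x : (S - T) x = S x - T x.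
Proof. by []. Qed.

Lemma spectrum_le_opnorm T a : spectrum T a -> rnorm a <= opnorm T.
Proof.
move=> /negP sa; rewrite leNgt; apply/negP => ha; apply: sa.
apply: (@bop_unit_bounded_below2 _ (rnorm a - opnorm T));
  rewrite ?subr_gt0// => x.
  rewrite bopBE scalarAE rnormBC mulrBl -rnormZ (le_trans _ (rnormB_ge _ _))//.
  by rewrite lerD2l lerN2 rnorm_opnorm.
rewrite adjointB adjoint_scalar bopBE scalarAE rnormBC mulrBl -(rnorm_conj a).
rewrite -rnormZ -(opnorm_adjoint T) (le_trans _ (rnormB_ge _ _))//.
by rewrite lerD2l lerN2 rnorm_opnorm.
Qed.

Lemma subr1_unit T : opnorm T < 1 -> 1 - T \is a GRing.unit.
Proof.
move=> T1; have : ~ spectrum T 1.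
  by move=> /spectrum_le_opnorm; rewrite rnormC normr1 leNgt T1.
by move=> /negP; rewrite negbK scale1r -opprB unitrN.
Qed.

Lemma opnorm_subr1_inv T : opnorm T < 1 -> opnorm (1 - T)^-1 <= (1 - opnorm
  T)^-1.
Proof.
move=> T1; have uT := subr1_unit T1;
  have T1' : 0 < 1 - opnorm T by rewrite subr_gt0.
apply: opnorm_le => [|x]; first by rewrite invr_ge0 ltW.
rewrite mulrC ler_pdivlMr// mulrC.
set y := (_^-1 : bop H) x; have -> : x = y - T y.
  by rewrite -[LHS]/((1 : bop H) x) -(mulrV uT).
rewrite mulrBl mul1r (le_trans _ (rnormB_ge _ _))//.
by rewrite lerD2l lerN2 rnorm_opnorm.
Qed.

Lemma spectral_radius_has_ubound T : has_ubound [set rnorm z | z in spectrum T].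
Proof. by exists (opnorm T) => _ [z /spectrum_le_opnorm ? <-]. Qed.

Lemma spectral_radius_ge T a : spectrum T a -> rnorm a <= spectral_radius T.
Proof.
by move=> sa; apply: ub_le_sup; [exact: spectral_radius_has_ubound|exists a].
Qed.

Lemma spectral_radius_le T (M : R) : 0 <= M ->
  (forall a, spectrum T a -> rnorm a <= M) -> spectral_radius T <= M.
Proof.
move=> M0 h; rewrite /spectral_radius; set E := [set _ | _ in _].
have [->|/set0P E0] := eqVneq E set0; first by rewrite sup0.
by apply: ge_sup => // _ [z /h ? <-].
Qed.

Lemma spectral_radius_ge0 T : 0 <= spectral_radius T.
Proof.
rewrite /spectral_radius; set E := [set _ | _ in _].
have [->|/set0P [r [z sz zr]]] := eqVneq E set0; first by rewrite sup0.
by rewrite (le_trans (rnorm_ge0 z))// spectral_radius_ge.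
Qed.

Lemma spectral_radius_le_opnorm T : spectral_radius T <= opnorm T.
Proof. apply: spectral_radius_le;
  [exact: opnorm_ge0|exact: spectrum_le_opnorm]. Qed.

(** Jacobson's identity: when [V] inverts [T * S - a], the operator [a^-1 *: (S * V * T - 1)]
    inverts [S * T - a]. The excluded value [a = 0] cannot affect a spectral radius. *)
Lemma spectrumM_comm S T a : a != 0 -> spectrum (S * T) a -> spectrum (T * S) a.
Proof.
move=> a0; apply: contraNN => /unitrP[V [VV' V'V]].
have V1 : V * T * S = 1 + a *: V.
  by rewrite -VV' mulrBr -scalerAr mulr1 mulrA subrK.
have V2 : T * S * V = 1 + a *: V.
  by rewrite -V'V mulrBl -scalerAl mul1r subrK.
apply/unitrP; exists (a^-1 *: (S * V * T - 1)); split.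
  rewrite -scalerAl mulrBl mul1r mulrBr -scalerAr mulr1.
  rewrite -!mulrA (mulrA V) (mulrA (V * T)) V1 mulrDl mul1r mulrDr.
  by rewrite -scalerAl -scalerAr addrK opprB addrC subrK scalerA mulVf ?scale1r.
rewrite -scalerAr mulrBr mulr1 mulrBl -scalerAl mul1r.
have -> : S * T * (S * V * T) = S * (T * S * V) * T by rewrite !mulrA.
rewrite V2.
rewrite mulrDr mulr1 mulrDl -scalerAr -scalerAl addrK opprB addrC subrK.
by rewrite scalerA mulVf ?scale1r.
Qed.

Lemma spectral_radiusMC S T : spectral_radius (S * T) = spectral_radius (T * S).
Proof.
have le (A B : bop H) : spectral_radius (A * B) <= spectral_radius (B * A).
  apply: spectral_radius_le => [|a sa]; first exact: spectral_radius_ge0.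
  have [->|a0] := eqVneq a 0; first by rewrite rnorm0 spectral_radius_ge0.
  exact/spectral_radius_ge/spectrumM_comm.
by apply/le_anti; rewrite !le.
Qed.

Lemma spectral_radius_conj S T : S \is a GRing.unit ->
  spectral_radius (S * T * S^-1) = spectral_radius T.
Proof. by move=> uS; rewrite spectral_radiusMC mulKr. Qed.

End invertibility.

(** * Polynomials in a self-adjoint operator *)

Section self_adjoint_polynomials.
Context {R : realType} {H : nzHilbertType R}.
Implicit Types (S T N : bop H) (x y z : H) (a : R[i]) (p q : {poly R}).

Lemma rdot_imagr x y : rdot x ('i%C *: y) = - rdot ('i%C *: x) y.
Proof.
by rewrite /rdot innerZl innerZr; case: (inner x y) => u v /=; ring.
Qed.

Lemma self_adjoint_rdot N x y : self_adjoint N -> rdot (N x) y = rdot x (N y).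
Proof. by move=> hN; rewrite rdot_adjoint hN. Qed.

Lemma self_adjoint_rdot_imag N x : self_adjoint N -> rdot (N x) ('i%C *: x) = 0.
Proof.
move=> hN; have : rdot (N x) ('i%C *: x) = - rdot (N x) ('i%C *: x).
  by rewrite {1}self_adjoint_rdot// bopZ [in RHS]rdot_imagr opprK rdotC.
lra.
Qed.

(** For [a = u + i v], the cross term between [(S - u) x] and [i v x] has real part zero, so the
    square of the right-hand side is [|(S - u) x|^2 + v^2 |x|^2]. *)
Lemma self_adjoint_Im_le S a x : self_adjoint S ->
  `|complex.Im a| * rnorm x <= rnorm ((S - a%:A) x).
Proof.
move=> hS; rewrite -ler_sqr ?nnegrE ?mulr_ge0 ?rnorm_ge0//.
rewrite bopBE scalarAE; case: a => u v;
  rewrite [complex.Im _]/= exprMn real_normK ?num_real//.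
have -> : (u +i* v)%C *: x = u%:C *: x + v%:C *: ('i%C *: x).
  by rewrite scalerA -scalerDl; congr (_ *: _); simpc.
rewrite opprD addrA rnormB_sqr rdotZr rdotBl self_adjoint_rdot_imag//.
rewrite rdotZl rdot_imagr rdotC.
have -> : rdot x ('i%C *: x) = 0.
  exact: (@self_adjoint_rdot_imag 1 x (@adjoint1 R H)).
rewrite oppr0 mulr0 subr0 mulr0 mulr0 subr0 rnormZR exprMn real_normK
  ?num_real//.
have -> : rnorm ('i%C *: x) = rnorm x.
  by rewrite rnormZ /rnorm normc_def/= expr0n expr1n/= add0r sqrtr1 mul1r.
by rewrite lerDr sqr_ge0.
Qed.

Lemma self_adjoint_spectrum_real S a : self_adjoint S -> spectrum S a ->
  a = (complex.Re a)%:C.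
Proof.
move=> hS sa; case: (eqVneq (complex.Im a) 0) => [|b0].
  by case: a sa => u v /= _ ->.
move/negP: sa; case; apply: (@bop_unit_bounded_below2 _ _ _ `|complex.Im a|).
- by rewrite normr_gt0.
- by move=> x; exact: self_adjoint_Im_le.
- move=> x; rewrite adjointB adjoint_scalar hS.
  rewrite (le_trans _ (self_adjoint_Im_le _ _ _))//.
  by case: a {b0} => u v /=; rewrite normrN.
Qed.

(** By Cauchy-Schwarz, [(c - t) |x|^2 <= <(S - t) x, x> <= |(S - t) x| |x|]; for [t < c] the
    self-adjoint [S - t] is therefore bounded below. *)
Lemma spectrum_ge S (c t : R) : self_adjoint S ->
  (forall x, c * rnorm x ^+ 2 <= rdot (S x) x) -> spectrum S t%:C -> c <= t.
Proof.
move=> hS Sc st; rewrite leNgt; apply/negP => tc; move/negP: st; apply.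
have ct : 0 < c - t by rewrite subr_gt0.
have bb x : (c - t) * rnorm x <= rnorm ((S - t%:C%:A) x).
  have := rdot_le ((S - t%:C%:A) x) x;
    rewrite bopBE scalarAE rdotBl rdotZl rdotxx.
  have := Sc x; have := rnorm_ge0 x; rewrite le_eqVlt => /predU1P[<-|x0].
    by move=> _ _; rewrite mulr0 rnorm_ge0.
  by move=> h1 h2; rewrite -(ler_pM2r x0); lra.
apply: (bop_unit_bounded_below2 ct bb) => x.
rewrite adjointB adjoint_scalar hS conjc_real.
exact: bb.
Qed.

(** With [c = |N|^2], expanding the square gives [|(N^2 - c) x|^2 <= c (c |x|^2 - |N x|^2)]. A
    bounded inverse of [N^2 - c] would then force [|N x|^2 <= (c - k^-1) |x|^2] for some [k > 0],
    against the definition of [c]. *)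
Lemma opnorm_sqr_spectrum N : self_adjoint N ->
  spectrum (N * N) (opnorm N ^+ 2)%:C.
Proof.
move=> hN; apply/negP => u; set c := opnorm N ^+ 2 in u.
have c0 : 0 <= c by exact: sqr_ge0.
set v := opnorm (N * N - c%:C%:A)^-1.
have v0 : 0 <= v by exact: opnorm_ge0.
have key x : rnorm x ^+ 2 <= v ^+ 2 * c * (c * rnorm x ^+ 2 - rnorm (N x) ^+ 2).
  have h : rnorm x ^+ 2 <= (v * rnorm ((N * N - c%:C%:A) x)) ^+ 2.
    by rewrite ler_sqr ?nnegrE ?mulr_ge0 ?rnorm_ge0// rnorm_unit_le.
  rewrite (le_trans h)// exprMn -mulrA ler_wpM2l ?sqr_ge0//.
  rewrite bopBE scalarAE rnormB_sqr rdotZr rnormZR exprMn ger0_norm//.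
  rewrite -[(N * N) x]/(N (N x)) self_adjoint_rdot// rdotxx.
  have : rnorm (N (N x)) ^+ 2 <= c * rnorm (N x) ^+ 2.
    by rewrite -exprMn ler_sqr ?nnegrE ?mulr_ge0 ?rnorm_ge0 ?opnorm_ge0
      ?rnorm_opnorm.
  lra.
(* A nonzero vector rules out [k = 0], and with it [N = 0]. It also makes [c - k^-1] nonnegative, so
   that its square root can bound [opnorm N]. *)
have [x0 nx0] := @hilbert_neq0 R H.
have x0_gt0 : 0 < rnorm x0 ^+ 2.
  rewrite exprn_gt0// lt_neqAle rnorm_ge0 andbT eq_sym.
  by apply: contra_neq nx0 => /rnorm0_eq0.
set k := v ^+ 2 * c in key.
have k0 : 0 < k.
  have : 0 <= k by rewrite mulr_ge0// sqr_ge0.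
  rewrite le_eqVlt => /predU1P[k0|//].
  by have := key x0; rewrite -k0 mul0r leNgt x0_gt0.
have key2 x : rnorm (N x) ^+ 2 <= (c - k^-1) * rnorm x ^+ 2.
  by have := key x; rewrite -ler_pdivrMl// mulrBl; lra.
have ck : 0 <= c - k^-1.
  by rewrite -(pmulr_lge0 _ x0_gt0) (le_trans _ (key2 x0))// sqr_ge0.
have : opnorm N <= Num.sqrt (c - k^-1).
  apply: opnorm_le => [|x]; first exact: sqrtr_ge0.
  rewrite -ler_sqr ?nnegrE ?mulr_ge0 ?rnorm_ge0 ?sqrtr_ge0//.
  by rewrite exprMn sqr_sqrtr.
rewrite -ler_sqr ?nnegrE ?opnorm_ge0 ?sqrtr_ge0// sqr_sqrtr//.
by rewrite -/c lerBrDr gerDl leNgt invr_gt0 k0.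
Qed.

Definition hornerR S p : bop H := horner_alg S (map_poly (real_complex R) p).

Lemma hornerRD S p q : hornerR S (p + q) = hornerR S p + hornerR S q.
Proof. by rewrite /hornerR !rmorphD. Qed.

Lemma hornerRB S p q : hornerR S (p - q) = hornerR S p - hornerR S q.
Proof. by rewrite /hornerR !rmorphB. Qed.

Lemma hornerRM S p q : hornerR S (p * q) = hornerR S p * hornerR S q.
Proof. by rewrite /hornerR !rmorphM. Qed.

Lemma hornerRC S (c : R) : hornerR S c%:P = c%:C%:A.
Proof. by rewrite /hornerR map_polyC horner_algC. Qed.

Lemma hornerRX S : hornerR S 'X = S.
Proof. by rewrite /hornerR map_polyX horner_algX. Qed.

Lemma hornerRXn S n : hornerR S 'X^n = S ^+ n.
Proof. by rewrite /hornerR map_polyXn rmorphXn/= horner_algX. Qed.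

Lemma hornerRZ S (c : R) p : hornerR S (c *: p) = c%:C *: hornerR S p.
Proof. by rewrite -mul_polyC hornerRM hornerRC -scalerAl mul1r. Qed.

Lemma hornerR_comp S p q : hornerR S (p \Po q) = hornerR (hornerR S q) p.
Proof.
elim/poly_ind: p => [|p c IH].
  by rewrite comp_poly0 -polyC0 !hornerRC.
by rewrite comp_polyD comp_polyM comp_polyX comp_polyC !hornerRD !hornerRM IH
  !hornerRC !hornerRX.
Qed.

Lemma self_adjoint_hornerR S p : self_adjoint S -> self_adjoint (hornerR S p).
Proof.
move=> hS; elim/poly_ind: p => [|p c IH].
  by rewrite -polyC0 hornerRC /self_adjoint adjoint_scalar conjc_real.
rewrite /self_adjoint hornerRD hornerRC adjointD adjoint_scalar conjc_real.
congr (_ + _); rewrite hornerRM adjointM hornerRX hS IH.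
by rewrite -{1}(hornerRX S) -hornerRM mulrC hornerRM hornerRX.
Qed.

(** Over [R[i]] the polynomial splits into linear factors; if [S - z] were invertible at every root
    [z], so would be the product. *)
Lemma horner_alg_spectrum S (p : {poly R[i]}) : p != 0 ->
  horner_alg S p \isn't a GRing.unit -> exists2 z, root p z & spectrum S z.
Proof.
move=> p0; have [r pE] := closed_field_poly_normal p.
have lp0 : lead_coef p != 0 by rewrite lead_coef_eq0.
move=> nu; apply: contrapT => hz; move/negP: nu; apply.
have hr (z : R[i]) : z \in r -> S - z%:A \is a GRing.unit.
  move=> zr; apply/negPn/negP => sz; apply: hz; exists z => //.
  by rewrite pE rootZ// root_prod_XsubC.
have -> : horner_alg S p = (lead_coef p)%:A * \prod_(z <- r) (S - z%:A).
  rewrite {1}pE -mul_polyC rmorphM/= horner_algC rmorph_prod/=.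
  congr (_ * _); apply: eq_bigr => z _.
  by rewrite rmorphB/= horner_algX horner_algC.
have uprod : \prod_(z <- r) (S - z%:A) \is a GRing.unit.
  elim: r hr {pE} => [|z r IH] hr; first by rewrite big_nil unitr1.
  rewrite big_cons unitrMl; first by rewrite hr// mem_head.
  by apply: IH => y yr; rewrite hr// inE yr orbT.
rewrite unitrMl//; apply/unitrP; exists (lead_coef p)^-1%:A.
by rewrite -!scalerAl !mul1r !scalerA mulVf// mulfV// scale1r.
Qed.

(** ['X - t] divides [p - p(t)], and both factors commute once evaluated at [S], so invertibility of
    the product would pass to [S - t]. *)
Lemma spectrum_hornerR S p (t : R) :
  spectrum S t%:C -> spectrum (hornerR S p) p.[t]%:C.
Proof.
apply: contraNN.
have /factor_theorem[q pq] : root (p - p.[t]%:P) t.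
  by rewrite /root hornerD hornerN hornerC subrr.
have -> : hornerR S p - p.[t]%:C%:A = hornerR S q * (S - t%:C%:A).
  by rewrite -(hornerRC S) -hornerRB pq hornerRM hornerRB hornerRX hornerRC.
rewrite unitrM_comm => [/andP[]//|].
have -> : S - t%:C%:A = hornerR S ('X - t%:P).
  by rewrite hornerRB hornerRX hornerRC.
by rewrite /GRing.comm -!hornerRM mulrC.
Qed.

Lemma spectrum_hornerR_norm S p (t : R) :
  spectrum S t%:C -> `|p.[t]| <= opnorm (hornerR S p).
Proof. by move=> /(spectrum_hornerR p)/spectrum_le_opnorm; rewrite rnormC. Qed.

Lemma map_real_complex_eq0 p : (map_poly (real_complex R) p == 0) = (p == 0).
Proof. exact: map_poly_eq0. Qed.

(** The nonzero polynomial [q = p^2 - |p(S)|^2] is singular at [S], hence has a root in the spectrum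
    of [S]. That root is real, and there [p] takes the value [|p(S)|] up to sign. *)
Lemma opnorm_hornerR_attained_nonconst S p : self_adjoint S ->
  p * p - (opnorm (hornerR S p) ^+ 2)%:P != 0 ->
  exists2 t : R, spectrum S t%:C & `|p.[t]| = opnorm (hornerR S p).
Proof.
move=> hS; set c := opnorm _ ^+ 2; set q := _ - _ => q0.
have qS : horner_alg S (map_poly (real_complex R) q) \isn't a GRing.unit.
  rewrite -[horner_alg _ _]/(hornerR S q) /q hornerRB hornerRM hornerRC.
  exact/opnorm_sqr_spectrum/self_adjoint_hornerR.
have [|z qz Sz] := horner_alg_spectrum _ qS;
  first by rewrite map_real_complex_eq0.
have zE := self_adjoint_spectrum_real hS Sz.
exists (complex.Re z); first by rewrite -zE.
move: qz; rewrite zE fmorph_root /root hornerD hornerN hornerC hornerM subr_eq0.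
rewrite -expr2 eqf_sqr => /orP[] /eqP ->; rewrite ?normrN ger0_norm//;
  exact: opnorm_ge0.
Qed.

(* When [p * p] is the constant [||p(S)||^2], any point of the spectrum will do;
   one is provided by the case of ['X]. *)
Lemma opnorm_hornerR_attained S p : self_adjoint S ->
  exists2 t : R, spectrum S t%:C & `|p.[t]| = opnorm (hornerR S p).
Proof.
move=> hS; case: (eqVneq (p * p - (opnorm (hornerR S p) ^+ 2)%:P) 0);
  last first.
  exact: opnorm_hornerR_attained_nonconst.
move=> pc; have [|t St _] := @opnorm_hornerR_attained_nonconst S 'X hS.
  rewrite -size_poly_gt0 -expr2 size_polyDl ?size_polyXn//.
  by rewrite size_polyN (leq_ltn_trans (size_polyC_leq1 _)).
exists t => //; have := congr1 (horner^~ t) pc.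
rewrite hornerD hornerN hornerC hornerM horner0 => /eqP.
rewrite subr_eq0 -expr2 eqf_sqr => /orP[] /eqP ->;
  rewrite ?normrN ger0_norm//; exact: opnorm_ge0.
Qed.

Lemma opnorm_hornerR_le S p (M : R) : self_adjoint S ->
  (forall t : R, spectrum S t%:C -> `|p.[t]| <= M) -> opnorm (hornerR S p) <= M.
Proof. by move=> hS pM; have [t /pM h <-] := opnorm_hornerR_attained p hS. Qed.

End self_adjoint_polynomials.

(** * Continuous functional calculus *)

Section functional_calculus.
Context {R : realType} {H : nzHilbertType R}.
Implicit Types (S T B C : bop H) (x y z : H) (p q : {poly R}) (f g : R -> R).

Lemma opnorm_complete (u : nat -> bop H) :
  (forall e : R, 0 < e -> exists N, forall m n, (N <= m)%N -> (N <= n)%N ->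
     opnorm (u m - u n) <= e) ->
  exists L, forall e : R, 0 < e -> exists N, forall n, (N <= n)%N ->
     opnorm (u n - L) <= e.
Proof.
move=> cu.
have ptw x : exists l, forall e : R, 0 < e -> exists N, forall n, (N <= n)%N ->
    rnorm (u n x - l) <= e.
  apply: rnorm_complete => e e0.
  have k0 : 0 < 1 + rnorm x by rewrite ltr_wpDr ?rnorm_ge0.
  have [|N uN] := cu (e / (1 + rnorm x)); first by rewrite divr_gt0.
  exists N => m n hm hn; rewrite -bopBE (le_trans (rnorm_opnorm _ _))//.
  rewrite (@le_trans _ _ (e / (1 + rnorm x) * (1 + rnorm x)))//;
    last by rewrite divfK ?gt_eqF.
  apply: ler_pM; rewrite ?opnorm_ge0 ?rnorm_ge0 ?uN//.
  by rewrite lerDr.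
have [l lP] := choice ptw.
have unif (e : R) : 0 < e -> exists N, forall n x, (N <= n)%N ->
    rnorm (u n x - l x) <= e * rnorm x.
  move=> e0; have [N uN] := cu e e0; exists N => n x Nn.
  apply/ler_addgt0Pr => d d0; have [N' lN'] := lP x d d0.
  pose m := maxn N N'.
  rewrite (le_trans (rnorm_triangle (u m x) _ _))// lerD ?lN' ?leq_maxr//.
  rewrite -bopBE (le_trans (rnorm_opnorm _ _))// ler_wpM2r ?rnorm_ge0//.
  by rewrite uN ?leq_maxl.
have lb : l \in bounded_linear.
  apply/bounded_linearP; split.
    move=> a x y; apply/eqP; rewrite -subr_eq0; apply/eqP/rnorm0_eq0.
    apply: (@small_eq0 _ _ (rnorm (a *: x + y) + rnorm (a *: x) + rnorm y)) =>
      e e0.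
    have [N uN] := unif e e0.
    have h1 := uN N (a *: x + y) (leqnn _).
    have h2 := uN N x (leqnn _); have h3 := uN N y (leqnn _).
    rewrite ger0_norm ?rnorm_ge0//.
    rewrite (le_trans (rnorm_triangle (u N (a *: x + y)) _ _))// rnormBC.
    rewrite -addrA mulrDr lerD//.
    rewrite bopD bopZ opprD addrACA -scalerBr (le_trans (rnormD _ _))// rnormZ.
    rewrite mulrDr lerD// rnormZ mulrCA ler_wpM2l ?rnorm_ge0//.
  have [N uN] := unif 1 ltr01; exists (opnorm (u N) + 1) => x.
  have := uN N x (leqnn _); rewrite mul1r mulrDl mul1r => h.
  have := rnorm_triangle (u N x) (l x) 0; rewrite !subr0 rnormBC.
  have := rnorm_opnorm (u N) x; lra.
exists (Bop lb) => e e0; have [N uN] := unif e e0; exists N => n Nn.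
by apply: opnorm_le => [|x]; [exact: ltW|rewrite bopBE uN].
Qed.

Local Notation fc := is_functional_calculus.

Lemma fc_ext f g S B : (forall t : R, spectrum S t%:C -> f t = g t) ->
  fc f S B -> fc g S B.
Proof.
move=> fg fB e e0; have [p [pf pB]] := fB e e0; exists p; split=> // t St.
by rewrite -fg// pf.
Qed.

Lemma fc_hornerR S p : fc (fun t => p.[t]) S (hornerR S p).
Proof.
move=> e e0; exists p; split=> [t _|]; first by rewrite subrr normr0 ltW.
by rewrite -[horner_alg _ _]/(hornerR S p) subrr opnorm0 ltW.
Qed.

Lemma fc_sub f g S B C : fc f S B -> fc g S C -> fc (fun t => f t - g t) S (B -
  C).
Proof.
move=> fB gC e e0; have e20 : 0 < e / 2 by rewrite divr_gt0.
have [p [pf pB]] := fB _ e20; have [q [qg qC]] := gC _ e20.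
exists (p - q); split=> [t St|].
  rewrite hornerD hornerN.
  have -> : p.[t] - q.[t] - (f t - g t) = (p.[t] - f t) - (q.[t] - g t) by ring.
  rewrite (le_trans (ler_normB _ _))//; have := pf t St; have := qg t St; lra.
rewrite -[horner_alg _ _]/(hornerR S (p - q)) hornerRB opprD opprK addrACA.
rewrite -[X in opnorm (_ + X)]opprK opprD opprK.
by rewrite (le_trans (opnormD _ _))// opnormN [e]splitr lerD.
Qed.

(** The bound for polynomials passes to the limit. Applied to differences, it yields the uniqueness
    of [f(S)], the convergence of the exponential series and the distance from [e^(2A)] to [P]. *)
Lemma fc_norm_le f S B (M : R) : self_adjoint S ->
  (forall t : R, spectrum S t%:C -> `|f t| <= M) -> fc f S B -> opnorm B <= M.
Proof.
move=> hS fM fB; apply/ler_addgt0Pr => e e0.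
have e20 : 0 < e / 2 by rewrite divr_gt0.
have [p [pf pB]] := fB _ e20.
have : opnorm (hornerR S p) <= M + e / 2.
  apply: opnorm_hornerR_le => // t St.
  have -> : p.[t] = f t + (p.[t] - f t) by ring.
  by rewrite (le_trans (ler_normD _ _))// lerD ?fM ?pf.
have := opnorm_triangle (hornerR S p) B 0; rewrite !subr0 opnormBC.
have : opnorm (hornerR S p - B) <= e / 2 by [].
lra.
Qed.

Lemma fc_uniq f S B C : self_adjoint S -> fc f S B -> fc f S C -> B = C.
Proof.
move=> hS fB fC; apply/eqP; rewrite -subr_eq0; apply/eqP/opnorm_eq0/le_anti.
rewrite opnorm_ge0 andbT; apply: fc_norm_le hS _ (fc_sub fB fC) => t _.
by rewrite subrr normr0.
Qed.

Lemma fc_bounded f S B : fc f S B ->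
  exists2 M, 0 < M & forall t : R, spectrum S t%:C -> `|f t| <= M.
Proof.
move=> /(_ 1 ltr01)[p [pf _]]; exists (opnorm (hornerR S p) + 1) => [|t St].
  by rewrite ltr_wpDl ?opnorm_ge0.
have -> : f t = p.[t] - (p.[t] - f t) by ring.
by rewrite (le_trans (ler_normB _ _))// lerD ?pf ?spectrum_hornerR_norm.
Qed.

Lemma fc_mul f g S B C : self_adjoint S -> fc f S B -> fc g S C ->
  fc (fun t => f t * g t) S (B * C).
Proof.
move=> hS fB gC e e0.
have [M M0 fM] := fc_bounded fB; have [N N0 gN] := fc_bounded gC.
have BM : opnorm B <= M by exact: fc_norm_le fB.
have CN : opnorm C <= N by exact: fc_norm_le gC.
(* Errors [d] in both factors give an error [d^2 + M d + d N] in the product, at most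
   [d (M + N + 1)] because [d <= 1]. *)
pose d := Num.min 1 (e / (M + N + 1)).
have k0 : 0 < M + N + 1 by rewrite !addr_gt0.
have d0 : 0 < d by rewrite lt_min ltr01 divr_gt0.
have d1 : d <= 1 by rewrite ge_min lexx.
have de : d * (M + N + 1) <= e by rewrite -ler_pdivlMr// ge_min lexx orbT.
have dd : d * d <= d by rewrite ler_piMr// ltW.
have [p [pf pB]] := fB _ d0; have [q [qg qC]] := gC _ d0.
exists (p * q); split=> [t St|].
  rewrite hornerM.
  have -> : p.[t] * q.[t] - f t * g t = (p.[t] - f t) * (q.[t] - g t)
      + (f t * (q.[t] - g t) + (p.[t] - f t) * g t) by ring.
  have h1 := ler_normD ((p.[t] - f t) * (q.[t] - g t))
    (f t * (q.[t] - g t) + (p.[t] - f t) * g t).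
  have h2 := ler_normD (f t * (q.[t] - g t)) ((p.[t] - f t) * g t).
  rewrite !normrM in h1 h2.
  have h3 := ler_pM (normr_ge0 _) (normr_ge0 _) (pf t St) (qg t St).
  have h4 := ler_pM (normr_ge0 _) (normr_ge0 _) (fM t St) (qg t St).
  have h5 := ler_pM (normr_ge0 _) (normr_ge0 _) (pf t St) (gN t St).
  lra.
rewrite -[horner_alg _ _]/(hornerR S (p * q)) hornerRM.
set P := hornerR S p; set Q := hornerR S q.
have -> : P * Q - B * C = (P - B) * (Q - C) + (B * (Q - C) + (P - B) * C).
  by rewrite (addrC (B * _)) addrA -mulrDr subrK mulrBl mulrBr addrA subrK.
have h1 := opnormD ((P - B) * (Q - C)) (B * (Q - C) + (P - B) * C).
have h2 := opnormD (B * (Q - C)) ((P - B) * C).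
have h3 := le_trans (opnormM (P - B) (Q - C))
  (ler_pM (opnorm_ge0 _) (opnorm_ge0 _) pB qC).
have h4 := le_trans (opnormM B (Q - C))
  (ler_pM (opnorm_ge0 _) (opnorm_ge0 _) BM qC).
have h5 := le_trans (opnormM (P - B) C)
  (ler_pM (opnorm_ge0 _) (opnorm_ge0 _) pB CN).
lra.
Qed.

Lemma fc_self_adjoint f S B : self_adjoint S -> fc f S B -> self_adjoint B.
Proof.
move=> hS fB; apply/eqP; rewrite -subr_eq0; apply/eqP/opnorm_eq0.
apply: (@small_eq0 _ _ 2) => e e0; rewrite ger0_norm ?opnorm_ge0//.
have [p [_ pB]] := fB e e0.
have pB' : opnorm (hornerR S p - B) <= e by [].
have := opnorm_triangle (hornerR S p) (adjoint B) B.
have -> : opnorm (adjoint B - hornerR S p) = opnorm (hornerR S p - B).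
  by rewrite -{1}(self_adjoint_hornerR p hS) -adjointB opnorm_adjoint opnormBC.
lra.
Qed.

(** Brings functions of [q(S)] into the calculus of [S], where they can be multiplied by or compared
    with other functions of [S]: [e^(-A)] with [e^A], and [e^(q(P))] with [P]. *)
Lemma fc_comp_hornerR g S q B : fc g (hornerR S q) B -> fc (fun t => g q.[t]) S
  B.
Proof.
move=> gB e e0; have [p [pg pB]] := gB e e0; exists (p \Po q); split=> [t St|].
  by rewrite horner_comp pg//; exact: spectrum_hornerR.
by rewrite -[horner_alg _ _]/(hornerR S (p \Po q)) hornerR_comp.
Qed.

Definition poly_approximable (A : set R) f := forall e : R, 0 < e ->
  exists p, forall t, A t -> `|p.[t] - f t| <= e.

Lemma fc_exists f S : self_adjoint S ->
  poly_approximable [set t | spectrum S t%:C] f -> exists B, fc f S B.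
Proof.
move=> hS fa.
have approx (n : nat) : exists p, forall t, spectrum S t%:C ->
    `|p.[t] - f t| <= n.+1%:R^-1.
  by apply: fa; rewrite invr_gt0.
have [p pP] := choice approx.
have pd (e : R) n t : 0 < e -> (Num.trunc e^-1 <= n)%N -> spectrum S t%:C ->
    `|(p n).[t] - f t| <= e.
  move=> e0 hn St; rewrite (le_trans (pP n t St))// invf_ple ?posrE//.
  by rewrite ltW// (lt_le_trans (truncnS_gt _))// ler_nat.
have [|B pB] := opnorm_complete (u := fun n => hornerR S (p n)).
  move=> e e0; have e20 : 0 < e / 2 by rewrite divr_gt0.
  exists (Num.trunc (e / 2)^-1) => m n hm hn; rewrite -hornerRB.
  apply: opnorm_hornerR_le => // t St; rewrite hornerD hornerN.
  rewrite (le_trans (ler_distD (f t) _ _))// (distrC (f t)).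
  by have := pd _ m t e20 hm St; have := pd _ n t e20 hn St; lra.
exists B => e e0; have [N uN] := pB e e0; pose n := maxn N (Num.trunc e^-1).
exists (p n); split=> [t St|]; first exact: pd (leq_maxr _ _) St.
exact: uN (leq_maxl _ _).
Qed.

End functional_calculus.

(** * Polynomial approximation *)

Section bernstein.
Context {R : realType}.
Implicit Types (g h f : nat -> R).

(** For [t] in [[0, 1]], the value at [t] is the expectation of [g k] for [k] binomial with
    parameters [n] and [t], obtained by conditioning on one trial. In this form monotonicity and the
    second moment follow by induction, without binomial coefficients. *)
Fixpoint bernstein n g : {poly R} :=
  if n is n'.+1 then 'X * bernstein n' (g \o succn) + (1 - 'X) * bernstein n' g
  else (g 0)%:P.

Lemma bernstein_le n g h (t : R) : 0 <= t <= 1 ->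
  (forall k, (k <= n)%N -> g k <= h k) ->
  (bernstein n g).[t] <= (bernstein n h).[t].
Proof.
move=> t01; elim: n g h => [|n IH] g h gh /=; first by rewrite !hornerC gh.
have t0 : 0 <= t by lra.
have t1 : 0 <= 1 - t by lra.
rewrite !(hornerE, hornerM) lerD// ler_wpM2l// IH// => k kn /=; apply: gh => //.
exact: ltnW.
Qed.

(* The variance [n t (1 - t)] of the binomial distribution. *)
Lemma bernstein_quadratic n (a b c t : R) :
  (bernstein n (fun k => a + b * (k%:R - c) ^+ 2)).[t] =
  a + b * ((n%:R * t - c) ^+ 2 + n%:R * t * (1 - t)).
Proof.
elim: n c => [|n IH] c; first by rewrite /= hornerC; ring.
have -> : bernstein n.+1 (fun k => a + b * (k%:R - c) ^+ 2) =
    'X * bernstein n (fun k => a + b * (k%:R - (c - 1)) ^+ 2) +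
    (1 - 'X) * bernstein n (fun k => a + b * (k%:R - c) ^+ 2).
  rewrite /=; congr (_ * bernstein _ _ + _); apply/funext => k /=.
  by rewrite -natr1; congr (_ + _ * _ ^+ 2); ring.
by rewrite !(hornerE, hornerM) !IH -natr1; ring.
Qed.

Lemma weierstrass01 (f : R -> R) (F : R) :
  (forall t, 0 <= t <= 1 -> `|f t| <= F) ->
  (forall e : R, 0 < e -> exists2 d : R, 0 < d &
     forall s t, 0 <= s <= 1 -> 0 <= t <= 1 -> `|s - t| <= d -> `|f s - f t| <=
       e) ->
  poly_approximable [set t | 0 <= t <= 1] f.
Proof.
move=> fF fu e e0; have e20 : 0 < e / 2 by rewrite divr_gt0.
have [d d0 fd] := fu _ e20.
have F0 : 0 <= F by rewrite (le_trans (normr_ge0 (f 0)))// fF// lexx ler01.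
(* Chebyshev's argument: where [k / n] is farther than [d] from [t], the term [K (k / n - t)^2]
   exceeds [2 F], which bounds any difference of values of [f]. Its expectation is
   [K t (1 - t) / n]. *)
pose K := 2 * F / d ^+ 2.
have K0 : 0 <= K by rewrite divr_ge0 ?sqr_ge0 ?mulr_ge0.
have [n n0 nK] : exists2 n, 0 < n%:R :> R & K / n%:R <= e / 2.
  exists (Num.trunc (2 * K / e)).+1; first by rewrite ltr0n.
  rewrite ler_pdivrMr ?ltr0n// -ler_pdivrMl// invf_div mulrC.
  by rewrite (_ : K * (2 / e) = 2 * K / e); [exact/ltW/truncnS_gt|ring].
exists (bernstein n (fun k => f (k%:R / n%:R))) => t /= t01.
have key k : (k <= n)%N ->
    `|f (k%:R / n%:R) - f t| <= e / 2 + K / n%:R ^+ 2 * (k%:R - n%:R * t) ^+ 2.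
  move=> kn; have k01 : 0 <= (k%:R / n%:R : R) <= 1.
    by rewrite divr_ge0// ler_pdivrMr// mul1r ler_nat.
  have -> : K / n%:R ^+ 2 * (k%:R - n%:R * t) ^+ 2 = K * (k%:R / n%:R - t) ^+ 2.
    by field; rewrite gt_eqF.
  have [h|h] := leP `|k%:R / n%:R - t| d.
    by rewrite (le_trans (fd _ _ _ _ h))// lerDl mulr_ge0 ?sqr_ge0.
  have : `|f (k%:R / n%:R) - f t| <= 2 * F.
    rewrite (le_trans (ler_normB _ _))//.
    by have := fF _ k01; have := fF _ t01; lra.
  have : 2 * F <= K * (k%:R / n%:R - t) ^+ 2.
    rewrite /K -mulrA ler_peMr ?mulr_ge0// mulrC ler_pdivlMr ?exprn_gt0//.
    by rewrite mul1r -(real_normK (num_real (_ - t))) ler_sqr ?nnegrE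
      ?normr_ge0 ?(ltW d0)// ltW.
  lra.
have var : K / n%:R ^+ 2 * ((n%:R * t - n%:R * t) ^+ 2 + n%:R * t * (1 - t)) <=
  e / 2.
  rewrite (le_trans _ nK)// (_ : K / n%:R ^+ 2 * _ = K / n%:R * (t * (1 - t))).
    by rewrite ler_piMr ?divr_ge0//; nra.
  by field; rewrite gt_eqF.
rewrite ler_distl; apply/andP; split.
  rewrite (@le_trans _ _ (bernstein n (fun k => (f t - e / 2) +
    (- (K / n%:R ^+ 2)) * (k%:R - n%:R * t) ^+ 2)).[t])//.
    rewrite bernstein_quadratic; lra.
  apply: bernstein_le => // k /key; rewrite ler_distl => /andP[]; lra.
rewrite (@le_trans _ _ (bernstein n (fun k => (f t + e / 2) +
    (K / n%:R ^+ 2) * (k%:R - n%:R * t) ^+ 2)).[t])//.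
  apply: bernstein_le => // k /key; rewrite ler_distl => /andP[]; lra.
rewrite bernstein_quadratic; lra.
Qed.

Lemma weierstrass (f : R -> R) (a b F : R) : a < b ->
  (forall t, a <= t <= b -> `|f t| <= F) ->
  (forall e : R, 0 < e -> exists2 d : R, 0 < d &
     forall s t, a <= s <= b -> a <= t <= b -> `|s - t| <= d -> `|f s - f t| <=
       e) ->
  poly_approximable [set t | a <= t <= b] f.
Proof.
move=> ab fF fu e e0; have ba0 : 0 < b - a by rewrite subr_gt0.
have rescale s : 0 <= s <= 1 -> a <= a + (b - a) * s <= b by nra.
have [|d d0|p hp] := @weierstrass01 (fun s => f (a + (b - a) * s)) F _ _ e e0.
- by move=> t t01; exact/fF/rescale.
- have [d' d'0 fd'] := fu _ d0; exists (d' / (b - a));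
  first by rewrite divr_gt0.
  move=> s t s01 t01 st; apply: fd'; [exact: rescale|exact: rescale|].
  rewrite (_ : _ - _ = (b - a) * (s - t)); last by ring.
  by rewrite normrM gtr0_norm// mulrC -ler_pdivlMr.
exists (p \Po ((b - a)^-1 *: ('X - a%:P))) => t /= tab.
have -> : f t = f (a + (b - a) * ((b - a)^-1 * (t - a))).
  by rewrite mulVKf ?gt_eqF// addrC subrK.
rewrite horner_comp hornerZ hornerD hornerN hornerX hornerC; apply: hp => /=.
apply/andP; split; last by rewrite ler_pdivrMl// mulr1; lra.
by apply: mulr_ge0; [rewrite invr_ge0 ltW|lra].
Qed.

(** For [0 < z <= x + y] the ratio [z / (x + y)] is at most its own power of exponent [r <= 1]; the
    inequalities for [z = x] and [z = y] add up, the ratios having sum [1]. *)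
Lemma powR_subadditive (r x y : R) : 0 <= r <= 1 -> 0 <= x -> 0 <= y ->
  (x + y) `^ r <= x `^ r + y `^ r.
Proof.
move=> /andP[r0 r1] x0 y0.
have [xy0|xy0] := eqVneq (x + y) 0.
  have [-> ->] : x = 0 /\ y = 0 by lra.
  by rewrite addr0 lerDl powR_ge0.
have xy : 0 < x + y by rewrite lt_neqAle eq_sym xy0 addr_ge0.
have part z : 0 <= z -> z <= x + y -> z / (x + y) * (x + y) `^ r <= z `^ r.
  move=> z0 zxy; have [->|zn0] := eqVneq z 0; first by rewrite !mul0r powR_ge0.
  have zp : 0 < z by rewrite lt_neqAle eq_sym zn0.
  rewrite -{2}(divfK xy0 z) powRM ?divr_ge0 ?(ltW xy)// ler_wpM2r ?powR_ge0//.
  by rewrite ger1_powR// divr_gt0//= ler_pdivrMr// mul1r.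
have h1 := part x x0; have h2 := part y y0.
rewrite (le_trans _ (lerD (h1 _) (h2 _))) ?lerDl ?lerDr//.
by rewrite -mulrDl -mulrDl divff// mul1r.
Qed.

Lemma powR_holder (r s t : R) : 0 <= r <= 1 -> 0 <= s -> 0 <= t ->
  `|s `^ r - t `^ r| <= `|s - t| `^ r.
Proof.
move=> r01; wlog st : s t / s <= t => [wl|] s0 t0.
  by case: (leP s t) => [|/ltW] h; [|rewrite distrC (distrC s)]; exact: wl.
have /andP[r0 r1] := r01.
rewrite distrC (distrC s) !ger0_norm ?subr_ge0//; last first.
  by apply: ge0_ler_powR; rewrite ?nnegrE.
by rewrite lerBlDl -{1}(subrKC s t) powR_subadditive// subr_ge0.
Qed.

Lemma powR_approximable (r M : R) : 0 <= r <= 1 ->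
  poly_approximable [set t | 0 <= t <= M] (fun t => t `^ r).
Proof.
move=> r01 e e0; have /andP[r0 r1] := r01.
have [->|rn0] := eqVneq r 0.
  exists 1%:P => t _; by rewrite hornerC powRr0 subrr normr0 ltW.
have rp : 0 < r by rewrite lt_neqAle eq_sym rn0.
have [||d d0|p hp] := @weierstrass (fun t => t `^ r) 0 (`|M| + 1) ((`|M| + 1)
  `^ r) _ _ _ e e0.
- by rewrite ltr_wpDl.
- move=> t /andP[t0 t1]; rewrite ger0_norm ?powR_ge0//.
  by apply: ge0_ler_powR; rewrite ?nnegrE ?addr_ge0.
- exists (d `^ r^-1); first exact: powR_gt0.
  move=> s t /andP[s0 _] /andP[t0 _] st;
    rewrite (le_trans (powR_holder _ _ _))//.
  rewrite -[leRHS](powRr1 (ltW d0)) -(mulVf rn0) powRrM.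
  by apply: ge0_ler_powR; rewrite ?nnegrE ?powR_ge0.
exists p => t /andP[t0 tM]; apply: hp => /=; rewrite t0 (le_trans tM)//.
by rewrite (le_trans (ler_norm _))// lerDl.
Qed.

Lemma ln_approximable (M : R) :
  poly_approximable [set t | 1 <= t <= M] (@ln R).
Proof.
move=> e e0.
have lip (s t : R) : 1 <= s -> 1 <= t -> `|ln s - ln t| <= `|s - t|.
  wlog st : s t / s <= t => [wl|] s1 t1.
    by case: (leP s t) => [|/ltW] h; [|rewrite distrC (distrC s)]; exact: wl.
  have s0 : 0 < s by lra.
  have t0 : 0 < t by lra.
  (* [1 + u <= e^u] at [u = ln (t / s)] bounds [ln t - ln s] by [t / s - 1], which is at most
     [t - s] because [s >= 1]. *)
  have := expR_ge1Dx (ln (t / s)); rewrite lnK ?posrE ?divr_gt0//.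
  rewrite ln_div ?posrE// => h.
  have h2 : t / s - 1 <= t - s.
    rewrite lerBlDr ler_pdivrMr//; nra.
  have h3 : ln s <= ln t by rewrite ler_ln ?posrE.
  rewrite distrC (distrC s) !ger0_norm ?subr_ge0//; lra.
(* The endpoint [|M| + 2] keeps the interval nondegenerate whatever the value of [M]. *)
have [||d d0|p hp] := @weierstrass (@ln R) 1 (`|M| + 2) (`|M| + 2) _ _ _ e e0.
- by have := normr_ge0 M; lra.
- move=> t t1; have := lip t 1; rewrite ln1 subr0 lexx => h.
  rewrite (le_trans (h _ _))//; first lra.
  by rewrite ger0_norm; have := normr_ge0 M; lra.
- exists d => // s t /andP[s1 _] /andP[t1 _].
  by apply: le_trans; exact: lip.
exists p => t /andP[t1 tM]; apply: hp => /=; rewrite t1 (le_trans tM)//.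
by rewrite (le_trans (ler_norm _))// lerDl.
Qed.

End bernstein.

(** * Powers, polar decomposition and the Aluthge transform *)

Section powers_of_positive_operators.
Context {R : realType} {H : nzHilbertType R}.
Implicit Types (S T A B C : bop H) (x y z : H) (r s : R).

Definition positive_op S := self_adjoint S /\ forall x, 0 <= rdot (S x) x.

Lemma positive_spectrum S (t : R) : positive_op S -> spectrum S t%:C ->
  0 <= t <= opnorm S.
Proof.
move=> [hS S0] St; apply/andP; split.
  by apply: (spectrum_ge hS _ St) => x; rewrite mul0r.
by have := spectrum_le_opnorm St; rewrite rnormC; apply/le_trans/ler_norm.
Qed.

Lemma op_powP S r : positive_op S -> 0 <= r <= 1 ->
  is_functional_calculus (fun t => t `^ r) S (op_pow S r).
Proof.
move=> pS r01; have [hS _] := pS.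
have [B SB] : exists B, is_functional_calculus (fun t => t `^ r) S B.
  apply: fc_exists => // e e0;
    have [p hp] := powR_approximable (opnorm S) r01 e0.
  by exists p => t /= St; apply/hp/positive_spectrum.
by rewrite /op_pow; case: xgetP => [C _|/(_ B)].
Qed.

Lemma op_powD S r s : positive_op S -> 0 <= r -> 0 <= s -> r + s <= 1 ->
  op_pow S r * op_pow S s = op_pow S (r + s).
Proof.
move=> pS r0 s0 rs1; have [hS _] := pS.
have hr : 0 <= r <= 1 by lra.
have hs : 0 <= s <= 1 by lra.
have hrs : 0 <= r + s <= 1 by lra.
apply: (fc_uniq hS) (op_powP pS hrs).
apply: fc_ext (fc_mul hS (op_powP pS hr) (op_powP pS hs)) => t _ /=.
(* At [t = 0] the addition rule for exponents is guarded by [r + s != 0]; otherwise both exponents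
   are [0] and all powers equal [1]. *)
have [rs0|rs0] := eqVneq (r + s) 0; last by rewrite powRD// (negbTE rs0).
by have [-> ->] : r = 0 /\ s = 0 by [lra]; rewrite addr0 !powRr0 mulr1.
Qed.

Lemma op_pow1 S : positive_op S -> op_pow S 1 = S.
Proof.
move=> pS; have [hS _] := pS.
have h1 : 0 <= (1 : R) <= 1 by rewrite ler01 lexx.
apply: (fc_uniq hS (op_powP pS h1)).
rewrite -{2}(hornerRX S); apply: fc_ext (fc_hornerR S 'X) => t St.
by rewrite hornerX powRr1//; have /andP[] := positive_spectrum pS St.
Qed.

Lemma opnorm_op_pow S r : positive_op S -> 0 <= r <= 1 ->
  opnorm (op_pow S r) <= opnorm S `^ r.
Proof.
move=> pS r01; have [hS _] := pS; have /andP[r0 r1] := r01.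
apply: (fc_norm_le hS _ (op_powP pS r01)) => t /(positive_spectrum pS)/andP[t0
  tS].
by rewrite ger0_norm ?powR_ge0// ge0_ler_powR// nnegrE opnorm_ge0.
Qed.

Lemma positive_sqr C : self_adjoint C -> positive_op (C * C).
Proof.
move=> hC; split; first by rewrite /self_adjoint adjointM hC.
move=> x; rewrite -[(C * C) x]/(C (C x)) self_adjoint_rdot// rdotxx;
  exact: sqr_ge0.
Qed.

Lemma positive_op_pow S r : positive_op S -> 0 <= r <= 1 ->
  positive_op (op_pow S r).
Proof.
move=> pS r01; have [hS _] := pS.
have -> : op_pow S r = op_pow S (r / 2) * op_pow S (r / 2).
  by rewrite op_powD// -?splitr//; lra.
by apply/positive_sqr/(fc_self_adjoint hS)/(op_powP pS); lra.
Qed.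

Lemma positive_adjoint_mul T : positive_op (adjoint T * T).
Proof.
split; first by rewrite /self_adjoint adjointM adjointK.
move=> x; rewrite -[(adjoint T * T) x]/(adjoint T (T x)) rdot_adjoint adjointK
  rdotxx.
exact: sqr_ge0.
Qed.

Lemma positive_op_abs T : positive_op (op_abs T).
Proof. by apply: positive_op_pow; [exact: positive_adjoint_mul|lra]. Qed.

Lemma op_abs_sqr T : op_abs T * op_abs T = adjoint T * T.
Proof.
rewrite /op_abs op_powD//; [|exact: positive_adjoint_mul|lra].
rewrite (_ : _ + _ = 1); last by lra.
exact/op_pow1/positive_adjoint_mul.
Qed.

Lemma rnorm_op_abs T x : rnorm (op_abs T x) = rnorm (T x).
Proof.
apply/eqP; rewrite -(@eqrXn2 _ 2) ?rnorm_ge0// -!rdotxx.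
have [hA _] := positive_op_abs T.
rewrite self_adjoint_rdot// -[op_abs T (op_abs T x)]/((op_abs T * op_abs T) x).
by rewrite op_abs_sqr rdot_adjoint.
Qed.

Lemma opnorm_op_abs_le T : opnorm (op_abs T) <= opnorm T.
Proof.
by apply: opnorm_le => [|x]; rewrite ?opnorm_ge0// rnorm_op_abs rnorm_opnorm.
Qed.

End powers_of_positive_operators.

(** * Polar decomposition; norm and spectral radius of the Aluthge transform *)

Section polar_decomposition.
Context {R : realType} {H : nzHilbertType R}.
Implicit Types (S T A B C U : bop H) (x y z : H) (r s : R).

Lemma kernel_closed_subspace T : closed_subspace [set x | T x = 0].
Proof.
split => [|x y /= Tx Ty|a x /= Tx|x h] /=.
- exact: bop0.
- by rewrite bopD Tx Ty addr0.
- by rewrite bopZ Tx scaler0.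
apply/rnorm0_eq0/(@small_eq0 _ _ (opnorm T)) => e e0.
have [y /= Ty xy] := h e e0; rewrite ger0_norm ?rnorm_ge0//.
rewrite -[T x]subr0 -Ty -bopB (le_trans (rnorm_opnorm _ _))// mulrC.
by rewrite ler_wpM2r ?opnorm_ge0.
Qed.

Definition range_closure A : set H :=
  [set z | forall e : R, 0 < e -> exists y, rnorm (z - A y) <= e].

Lemma range_closure_closed_subspace A : closed_subspace (range_closure A).
Proof.
split => [e e0|x y hx hy e e0|a x hx e e0|x h e e0].
- by exists 0; rewrite bop0 subrr rnorm0 ltW.
- have e20 : 0 < e / 2 by rewrite divr_gt0.
  have [u xu] := hx _ e20; have [v yv] := hy _ e20; exists (u + v).
  rewrite bopD opprD addrACA (le_trans (rnormD _ _))//; lra.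
- have k0 : 0 < rnorm a + 1 by rewrite ltr_wpDl ?rnorm_ge0.
  have [|u xu] := hx (e / (rnorm a + 1)); first by rewrite divr_gt0.
  exists (a *: u); rewrite bopZ -scalerBr rnormZ.
  rewrite (@le_trans _ _ ((rnorm a + 1) * (e / (rnorm a + 1))))//.
    by apply: ler_pM; rewrite ?rnorm_ge0// lerDl.
  by rewrite mulrC divfK// gt_eqF.
- have e20 : 0 < e / 2 by rewrite divr_gt0.
  have [y hy xy] := h _ e20; have [u yu] := hy _ e20; exists u.
  rewrite (le_trans (rnorm_triangle y _ _))//; lra.
Qed.

Lemma orthogonal_decomposition_uniq (M : set H) x u v : closed_subspace M ->
  M u -> M v -> (forall m, M m -> inner (x - u) m = 0) ->
  (forall m, M m -> inner (x - v) m = 0) -> u = v.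
Proof.
move=> cM Mu Mv xu xv; apply/eqP; rewrite -subr_eq0; apply/eqP/rnorm0_eq0.
have Muv := closed_subspaceB cM Mu Mv.
apply/eqP; rewrite -sqrf_eq0 -rdotxx.
have -> : rdot (u - v) (u - v) = rdot (x - v) (u - v) - rdot (x - u) (u - v).
  by rewrite !rdotBl; ring.
by rewrite /rdot xu// xv// subrr.
Qed.

Lemma rnorm_projection_le (M : set H) x p : M p ->
  (forall m, M m -> inner (x - p) m = 0) -> rnorm p <= rnorm x.
Proof.
move=> Mp op; rewrite -ler_sqr ?nnegrE ?rnorm_ge0//.
have o : rdot (x - p) p = 0 by rewrite /rdot op.
by rewrite -(subrK p x) rnormD_sqr o mulr0 addr0 lerDr sqr_ge0.
Qed.

(** The definition only speaks of vectors orthogonal to the kernel; removing from [x] its projection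
    [k] on the kernel leaves [U x] unchanged and does not increase the norm. *)
Lemma partial_isometry_opnorm_le U : partial_isometry U -> opnorm U <= 1.
Proof.
move=> pU; apply: opnorm_le => // x; rewrite mul1r.
have [k /= Uk ok] := projection_theorem x (kernel_closed_subspace U).
have -> : rnorm (U x) = rnorm (x - k).
  rewrite /rnorm -(pU (x - k)); first by rewrite bopB Uk subr0.
  by move=> y Uy; rewrite ok.
have o : rdot (x - k) k = 0 by rewrite /rdot ok.
rewrite -ler_sqr ?nnegrE ?rnorm_ge0// -[in leRHS](subrK k x) [leRHS]rnormD_sqr
  o mulr0 addr0.
by rewrite lerDl sqr_ge0.
Qed.

Section isometric_extension.
Context (A T : bop H) (AT : forall x, rnorm (A x) = rnorm (T x)).

(* The closure in [H * H] of the graph of the isometry [A y |-> T y]. *)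
Let G z w := forall e : R, 0 < e ->
  exists y, rnorm (z - A y) <= e /\ rnorm (w - T y) <= e.

Let G_linear (a : R[i]) z w z' w' : G z w -> G z' w' -> G (a *: z + z') (a *: w
  + w').
Proof.
move=> g g' e e0.
have k0 : 0 < rnorm a + 1 by rewrite ltr_wpDl ?rnorm_ge0.
pose d := e / (rnorm a + 1).
have d0 : 0 < d by rewrite divr_gt0.
have dE : rnorm a * d + d = e by rewrite -{2}[d]mul1r -mulrDl mulrC divfK//
  gt_eqF.
have [y [zy wy]] := g d d0; have [y' [zy' wy']] := g' d d0.
exists (a *: y + y'); split; rewrite bopD bopZ opprD addrACA -scalerBr -dE.
all: rewrite (le_trans (rnormD _ _))// rnormZ lerD// ler_wpM2l ?rnorm_ge0//.
Qed.

Let G_isometry z w : G z w -> rnorm w = rnorm z.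
Proof.
move=> g; apply/eqP; rewrite -subr_eq0; apply/eqP.
apply: (@small_eq0 _ _ 2) => e e0; have [y [zy wy]] := g e e0.
have h1 := rnormB_ge z (A y); have h2 := rnormB_ge (A y) z.
have h3 := rnormB_ge w (T y); have h4 := rnormB_ge (T y) w.
rewrite rnormBC in h2; rewrite rnormBC in h4; have := AT y.
rewrite ler_norml => AyTy; apply/andP; split; lra.
Qed.

(** By linearity [(0, w' - w)] also lies in the closed graph, whose pairs have equal norms. *)
Let G_uniq z w w' : G z w -> G z w' -> w = w'.
Proof.
move=> g g'; have := G_isometry (G_linear (-1) g g').
rewrite !scaleN1r addNr rnorm0 => /rnorm0_eq0/eqP.
by rewrite addrC subr_eq0 => /eqP ->.
Qed.

Let G_exists z : range_closure A z -> exists w, G z w.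
Proof.
move=> hz.
have h (n : nat) : exists y, rnorm (z - A y) <= n.+1%:R^-1.
  by apply: hz; rewrite invr_gt0.
have [u uP] := choice h.
have ud (e : R) n : 0 < e -> (Num.trunc e^-1 <= n)%N -> rnorm (z - A (u n)) <=
  e.
  move=> e0 hn; rewrite (le_trans (uP n))// invf_ple ?posrE//.
  by rewrite ltW// (lt_le_trans (truncnS_gt _))// ler_nat.
have [|w uw] := rnorm_complete (u := fun n => T (u n)).
  move=> e e0; have e20 : 0 < e / 2 by rewrite divr_gt0.
  exists (Num.trunc (e / 2)^-1) => m n hm hn.
  rewrite -bopB -AT bopB (le_trans (rnorm_triangle z _ _))// (rnormBC _ z).
  by have := ud _ m e20 hm; have := ud _ n e20 hn; lra.
exists w => e e0; have [N uN] := uw e e0; pose n := maxn N (Num.trunc e^-1).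
exists (u n); split; first exact: ud (leq_maxr _ _).
by rewrite rnormBC uN// leq_maxl.
Qed.

(** [U] is the orthogonal projection [p] onto the closed range of [A], followed by the continuous
    extension [A y |-> T y]. For [A = op_abs T], self-adjointness and [|A x| = |T x|] turn the
    orthogonal complement of the range of [A] into the kernel of [T]. *)
Lemma isometric_extension : exists U, [/\ partial_isometry U,
  forall x, (U x = 0 <-> forall y, inner x (A y) = 0) & T = U * A].
Proof.
have cM := range_closure_closed_subspace A; set M := range_closure A in cM.
have MA y : M (A y) by move=> e e0; exists y; rewrite subrr rnorm0 ltW.
have pex x : exists p, M p /\ forall m, M m -> inner (x - p) m = 0.
  by have [p] := projection_theorem x cM; exists p.
have [p pP] := choice pex.
have pM x : M (p x) by have [] := pP x.
have po x m : M m -> inner (x - p x) m = 0 by have [_] := pP x; apply.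
have pE x v : M v -> (forall m, M m -> inner (x - v) m = 0) -> p x = v.
  by move=> Mv xv; apply: (orthogonal_decomposition_uniq cM _ _ (po x)).
have pG x : exists w, G (p x) w by apply: G_exists; exact: pM.
have [f fG] := choice pG.
have fn x : rnorm (f x) = rnorm (p x) by exact: G_isometry.
have [_ MD MZ _] := cM.
have fb : f \in bounded_linear.
  apply/bounded_linearP; split.
    move=> a x y; apply: (G_uniq (fG _)).
    rewrite (_ : p (a *: x + y) = a *: p x + p y); first exact: G_linear.
    apply: pE => [|m Mm]; first by apply: MD => //; exact: MZ.
    by rewrite opprD addrACA -scalerBr innerDl innerZl !po// mulr0 addr0.
  by exists 1 => x; rewrite mul1r fn; apply: rnorm_projection_le (po x).
pose U := Bop fb.
have UA x : U (A x) = T x.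
  apply: (G_uniq (fG _)); rewrite (pE (A x) (A x))// => [e e0|m Mm].
    by exists x; rewrite !subrr !rnorm0 ltW.
  by rewrite subrr inner0l.
have U0 x : U x = 0 <-> forall m, M m -> inner x m = 0.
  split => [Ux m Mm|xM]; last first.
    apply: rnorm0_eq0; rewrite -[U x]/(f x) fn (pE x 0) ?rnorm0//;
      first by case: cM.
    by move=> m Mm; rewrite subr0 xM.
  have px0 : p x = 0 by apply: rnorm0_eq0; rewrite -fn -[f x]/(U x) Ux rnorm0.
  by have := po x m Mm; rewrite px0 subr0.
exists U; split.
- move=> x xU; rewrite -!rnormE; congr (_%:C)%C; rewrite -[U x]/(f x) fn.
  have Ur : U (x - p x) = 0 by apply/U0 => m Mm; exact: po.
  (* [x - p x] lies in the kernel of [U], so it is orthogonal to [x]; it is orthogonal to [p x] as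
     well, hence to itself. *)
  have : inner (x - p x) (x - p x) = 0.
    by rewrite innerBl (xU _ Ur) (innerC (p x)) po// conjc0 subr0.
  move=> h; suff -> : p x = x by [].
  apply/esym/eqP; rewrite -subr_eq0; apply/eqP/rnorm0_eq0/eqP.
  by rewrite -sqrf_eq0 -rdotxx /rdot h.
- move=> x; split => [/U0 h y|h]; first exact: h.
  apply/U0 => m Mm.
  have small z : (forall y, rdot z (A y) = 0) -> rdot z m = 0.
    move=> hz; apply: (@small_eq0 _ _ (rnorm z)) => e e0.
    have [y my] := Mm e e0; rewrite -[rdot _ _]subr0 -(hz y) -rdotBr.
    by rewrite (le_trans (norm_rdot_le _ _))// mulrC ler_wpM2r ?rnorm_ge0.
  rewrite inner_rdot small => [|y]; last by rewrite /rdot h.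
  rewrite rdot_imagr small ?oppr0// => y.
  by rewrite /rdot innerZl h mulr0.
- by apply: bop_ext => x; rewrite -UA.
Qed.

End isometric_extension.

Lemma polarP T : [/\ partial_isometry (polar T),
  (forall x, polar T x = 0 <-> T x = 0) & T = polar T * op_abs T].
Proof.
rewrite /polar; case: xgetP => [U _ //|].
have [U [pU U0 UT]] := isometric_extension (rnorm_op_abs T).
have [hA _] := positive_op_abs T.
move=> /(_ U); case; split => // x; rewrite U0; split => [h|Tx y].
  apply: rnorm0_eq0; rewrite -rnorm_op_abs.
  suff -> : op_abs T x = 0 by rewrite rnorm0.
  by apply: rdot_eq0 => y; rewrite self_adjoint_rdot// /rdot h.
have A0 : op_abs T x = 0 by apply: rnorm0_eq0; rewrite rnorm_op_abs Tx rnorm0.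
by rewrite -hA -adjointP A0 inner0l.
Qed.

(** The polar factor is a contraction and the outer factors have norms at most the powers of the
    norm of [op_abs T] with exponents [lambda] and [1 - lambda], whose sum is [1]. *)
Lemma opnorm_aluthge_le (lambda : R) T : 0 <= lambda <= 1 ->
  opnorm (aluthge lambda T) <= opnorm T.
Proof.
move=> l01; have pA := positive_op_abs T; have [pU _ _] := polarP T.
have l01' : 0 <= 1 - lambda <= 1 by lra.
rewrite /aluthge (le_trans (opnormM _ _))//.
rewrite (@le_trans _ _ (opnorm (op_abs T) `^ lambda * 1 *
    opnorm (op_abs T) `^ (1 - lambda)))//.
  apply: ler_pM; rewrite ?opnorm_ge0 ?opnorm_op_pow//.
  rewrite (le_trans (opnormM _ _))//.
  by apply: ler_pM; rewrite ?opnorm_ge0 ?opnorm_op_pow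
    ?partial_isometry_opnorm_le.
rewrite mulr1 -powRD addrC subrK ?oner_eq0//.
by rewrite powRr1 ?opnorm_ge0// opnorm_op_abs_le.
Qed.

Lemma spectral_radius_aluthge (lambda : R) T : 0 <= lambda <= 1 ->
  spectral_radius (aluthge lambda T) = spectral_radius T.
Proof.
move=> /andP[l0 l1]; have [_ _ UT] := polarP T; have pA := positive_op_abs T.
rewrite /aluthge -mulrA spectral_radiusMC -mulrA op_powD//; try lra.
by rewrite subrK op_pow1// -UT.
Qed.

Lemma spectral_radius_le_opnorm_aluthge (lambda : R) T : 0 <= lambda <= 1 ->
  spectral_radius T <= opnorm (aluthge lambda T).
Proof. by move=> l01;
  rewrite -(spectral_radius_aluthge T l01) spectral_radius_le_opnorm. Qed.

End polar_decomposition.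

(** * Spectral radius and powers *)

Section compact_disc.
Context {R : realType}.

Lemma rnorm_le_Re_Im (u : R[i]) : rnorm u <= `|complex.Re u| + `|complex.Im u|.
Proof.
have -> : u = (complex.Re u)%:C + 'i%C * (complex.Im u)%:C.
  by case: u => a b; simpc.
rewrite (le_trans (rnormD _ _))// rnormM !rnormC.
rewrite (_ : rnorm 'i%C = 1) ?mul1r;
  last by rewrite /rnorm normc_def/= expr0n expr1n/= add0r sqrtr1.
by case: u => a b /=;
  rewrite !mul0r !mul1r !subr0 ?addr0 ?add0r ?mulr0 ?oppr0 ?addr0 ?add0r.
Qed.

(** Compactness of the square [[-D, D]^2], which contains the disc. The covering is indexed by the
    candidate bounds [n] in the filter at infinity, and radius [d / 2] in each coordinate suffices
    since [|u| <= |Re u| + |Im u|]. *)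
Lemma disc_bound_of_local_bound (D : R) (P : R[i] -> R -> Prop) :
  (forall u M N, M <= N -> P u M -> P u N) ->
  (forall u, exists2 d : R, 0 < d & exists M, forall v, rnorm (v - u) < d -> P
    v M) ->
  exists M, forall u, rnorm u <= D -> P u M.
Proof.
move=> Pmono Ploc.
pose K : set (R * R) := `[- D, D] `*` `[- D, D].
have cK : near_covering K by apply/compact_near_coveringP/compact_setX;
  exact: segment_compact.
have [|N _ KN] := cK nat \oo (fun n z => P (z.1 +i* z.2)%C n%:R) _.
  move=> [x y] _; have [d d0 [M PM]] := Ploc (x +i* y)%C.
  have d20 : 0 < d / 2 by rewrite divr_gt0.
  exists (ball (x, y) (d / 2), [set n | (Num.trunc M < n)%N]) => /=.
    by split; [exact: nbhsx_ballx|exists (Num.trunc M).+1].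
  move=> [[x' y'] n] /= [[/= xx' yy'] Mn].
  apply: (Pmono _ M); last first.
    apply: PM; rewrite (le_lt_trans (rnorm_le_Re_Im _))//=.
    by move: xx' yy'; rewrite /ball/= distrC (distrC y); lra.
  by rewrite ltW// (lt_le_trans (truncnS_gt _))// ler_nat.
exists N%:R => u uD.
have Re_le : `|complex.Re u| <= D.
  by rewrite (le_trans _ uD)// -lecR rnormE normc_ge_Re.
have Im_le : `|complex.Im u| <= D.
  rewrite (le_trans _ uD)// -ler_sqr ?nnegrE ?rnorm_ge0// real_normK
    ?num_real//.
  have -> : rnorm u ^+ 2 = complex.Re u ^+ 2 + complex.Im u ^+ 2.
    by apply: complexI; rewrite add_Re2_Im2 rmorphXn/= rnormE.
  by rewrite lerDr sqr_ge0.
have := KN N (leqnn N) (complex.Re u, complex.Im u).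
case: u {uD} Re_le Im_le => a b /= al bl; apply.
by split => /=; rewrite in_itv/= -ler_norml.
Qed.

End compact_disc.

Section power_bound.
Context {R : realType} {H : nzHilbertType R}.
Implicit Types (S T U X : bop H) (u v : R[i]).

Lemma opnorm_inv_le T (c : R) : 0 <= c -> T \is a GRing.unit ->
  (forall x, rnorm x <= c * rnorm (T x)) -> opnorm T^-1 <= c.
Proof.
move=> c0 uT Tc; apply: opnorm_le => // x; rewrite (le_trans (Tc _))//.
by rewrite -[T (_ x)]/((T * T^-1) x) mulrV.
Qed.

(** [|S| <= 1/8] puts [(1 - S)^-1] within [1/8 * 8/7 = 1/7] of [1], and [1/7 + 1/4 <= 1/2]. So
    [E = (1 - U)^-1 - 1] has norm at most [1/2], and [U = E - E U] gives [|U| <= 1/2 + |U| / 2]. *)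
Lemma opnorm_le1_of_resolvent_close S U :
  1 - S \is a GRing.unit -> opnorm S <= 8^-1 -> 1 - U \is a GRing.unit ->
  opnorm ((1 - S)^-1 - (1 - U)^-1) <= 4^-1 -> opnorm U <= 1.
Proof.
move=> uS S8 uU SU.
have GS : opnorm ((1 - S)^-1 - 1) <= 7^-1.
  have -> : (1 - S)^-1 - 1 = S * (1 - S)^-1.
    apply: (mulIr uS); rewrite mulrBl mulVr// mul1r opprB addrCA subrr addr0.
    by rewrite -mulrA mulVr// mulr1.
  have S1 : opnorm S < 1 by move: (opnorm S) S8 => a; clear; lra.
  have h : opnorm (1 - S)^-1 <= 8 / 7.
    rewrite (le_trans (opnorm_subr1_inv S1))// -[8 / 7]invf_div lef_pV2 ?posrE.
    - by move: (opnorm S) S8 => a; clear; lra.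
    - by rewrite subr_gt0.
    - by [].
  rewrite (le_trans (opnormM _ _))// (le_trans (ler_pM _ _ S8 h)) ?opnorm_ge0//.
  by rewrite mulrA mulVf// mul1r.
have GU : opnorm ((1 - U)^-1 - 1) <= 2^-1.
  rewrite (le_trans (opnorm_triangle (1 - S)^-1 _ _))// opnormBC.
  by rewrite (le_trans (lerD SU GS))//; clear; lra.
set E := (1 - U)^-1 - 1 in GU.
have UE : U = E - E * U.
  rewrite -{1}[E]mulr1 -mulrBr mulrBl mulVr// mul1r.
  by rewrite opprB addrCA subrr addr0.
have h1 : opnorm U <= opnorm E + opnorm E * opnorm U.
  by rewrite {1}UE (le_trans (opnormD _ _))// lerD2l opnormN opnormM.
have := le_trans h1 (lerD GU (ler_wpM2r (opnorm_ge0 U) GU)).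
by move: (opnorm U) => a; clear; lra.
Qed.

Section fixed_operator.
Context (T : bop H) (D : R) (D0 : 0 < D).
Context (TD : forall z : R[i], D^-1 <= rnorm z -> ~ spectrum T z).

(** [1 - u T] equals [- u (T - u^-1)], and [u^-1] lies outside the open disc of radius [D^-1] that
    contains the spectrum by assumption. *)
Let disc_unit u : rnorm u <= D -> 1 - u *: T \is a GRing.unit.
Proof.
move=> uD; have [->|u0] := eqVneq u 0; first by rewrite scale0r subr0 unitr1.
have nu0 : 0 < rnorm u.
  rewrite lt_neqAle rnorm_ge0 andbT eq_sym.
  by apply: contra_neq u0 => /rnorm0_eq0.
have /TD/negP : D^-1 <= rnorm u^-1.
  have h : rnorm u^-1 * rnorm u = 1 by rewrite -rnormM mulVf// rnormC normr1.
  have -> : rnorm u^-1 = (rnorm u)^-1.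
    by apply: (mulIf (lt0r_neq0 nu0)); rewrite h mulVf// lt0r_neq0.
  by rewrite lef_pV2.
rewrite negbK => uz.
have -> : 1 - u *: T = (- u)%:A * (T - u^-1%:A).
  rewrite -scalerAl mul1r scalerBr scalerA mulNr mulfV// !scaleNr scale1r.
  by rewrite opprK addrC.
rewrite unitrMl//; apply/unitrP; exists (- u)^-1%:A.
by rewrite -!scalerAl !mul1r !scalerA mulVf ?mulfV ?oppr_eq0// scale1r.
Qed.

Let resolvent_bound : exists2 K, 0 <= K &
  forall u, rnorm u <= D -> opnorm (1 - u *: T)^-1 <= K.
Proof.
pose P u M := rnorm u <= D -> opnorm (1 - u *: T)^-1 <= M.
have [||K PK] := @disc_bound_of_local_bound R D P.
- by move=> u M N MN PM uD; rewrite (le_trans (PM uD)).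
- move=> u; have [uD|uD] := leP (rnorm u) D; last first.
    exists (rnorm u - D); first by rewrite subr_gt0.
    exists 0 => v vu vD; have := rnormB_ge u v; rewrite rnormBC; lra.
  set V := opnorm (1 - u *: T)^-1; have V0 : 0 <= V by exact: opnorm_ge0.
  have k0 : 0 < 2 * (V * opnorm T + 1).
    by rewrite mulr_gt0// ltr_wpDl// mulr_ge0// opnorm_ge0.
  (* At this distance the perturbation [(v - u) T] costs at most half of [|x|]:
     [|x| <= V |(1 - v T) x| + |x| / 2], whence the bound [2 * V]. *)
  exists (2 * (V * opnorm T + 1))^-1; first by rewrite invr_gt0.
  exists (2 * V) => v vu vD; apply: opnorm_inv_le (disc_unit vD) _ => [|x].
    by rewrite mulr_ge0.
  have h1 := rnorm_unit_le x (disc_unit uD); rewrite -/V in h1.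
  have h2 : rnorm ((1 - u *: T) x) <= rnorm ((1 - v *: T) x) +
      rnorm (v - u) * (opnorm T * rnorm x).
    have -> : (1 - u *: T) x = (1 - v *: T) x + (v - u) *: T x.
      rewrite scalerBl -[(1 - u *: T) x]/(x - u *: T x).
      by rewrite -[(1 - v *: T) x]/(x - v *: T x) addrA subrK.
    by rewrite (le_trans (rnormD _ _))// lerD2l rnormZ ler_wpM2l ?rnorm_ge0//
      rnorm_opnorm.
  have h3 : V * (rnorm (v - u) * (opnorm T * rnorm x)) <= 2^-1 * rnorm x.
    rewrite !mulrA ler_wpM2r ?rnorm_ge0// mulrAC.
    have h : rnorm (v - u) * (2 * (V * opnorm T + 1)) <= 1.
      by rewrite -ler_pdivlMr// mul1r ltW.
    have := rnorm_ge0 (v - u); lra.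
  have h4 := ler_wpM2l V0 h2; rewrite mulrDr in h4.
  have h5 := le_trans h1 (le_trans h4 (lerD (lexx _) h3)).
  rewrite -mulrA; move: h5; move: (rnorm x) (V * _) => a b; lra.
exists (Num.max K 0); first by rewrite le_max lexx orbT.
by move=> u uD; rewrite le_max PK.
Qed.

Let root_of_minus1 k : exists2 z : R[i], z ^+ (2 ^ k)%N = -1 & rnorm z = 1.
Proof.
elim: k => [|k [z zk z1]].
  by exists (-1); rewrite ?expr1// rnormN rnormC normr1.
exists (sqrtC z); first by rewrite expnS exprM sqrtCK.
apply/eqP; rewrite -(@eqrXn2 _ 2) ?rnorm_ge0// expr1n.
by rewrite expr2 -rnormM -expr2 sqrtCK z1.
Qed.

Lemma invrB S U : S \is a GRing.unit -> U \is a GRing.unit ->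
  S^-1 - U^-1 = S^-1 * (U - S) * U^-1.
Proof. by move=> uS uU; rewrite mulrBr mulVr// mulrBl mulrK// mul1r. Qed.

Lemma inv_subr1_sqr X : 1 - X \is a GRing.unit -> 1 + X \is a GRing.unit ->
  1 - X * X \is a GRing.unit /\
  (1 - X * X)^-1 = (2^-1 : R)%:C *: ((1 - X)^-1 + (1 + X)^-1).
Proof.
move=> um up.
have E1 : 1 - X * X = (1 - X) * (1 + X).
  by rewrite mulrDr mulr1 mulrBl mul1r addrA subrK.
have E2 : 1 - X * X = (1 + X) * (1 - X).
  by rewrite mulrBr mulr1 mulrDl mul1r opprD addrA addrK.
have u : 1 - X * X \is a GRing.unit by rewrite E1 unitrMl.
split=> //; apply: (mulrI u); rewrite mulrV// -scalerAr mulrDr.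
rewrite {1}E2 E1 -!mulrA mulrV// mulr1.
have -> : (1 - X) * ((1 + X) * (1 + X)^-1) = 1 - X by rewrite mulrV// mulr1.
rewrite addrCA addrK.
have -> : (1 : bop H) + 1 = (2 : R)%:C%:A.
  by rewrite -{1 2}(scale1r (1 : bop H)) -scalerDl; congr (_ *: _);
    rewrite rmorphD.
by rewrite scalerA -rmorphM/= mulVf// scale1r.
Qed.

(* If [z ^+ (2 ^ k) = -1], then [(1 - (u T)^(2^(k+1)))^-1] is the mean of the
   inverses for the exponent [2 ^ k] at [u] and at [z * u]; hence a Lipschitz
   constant that does not depend on [k]. *)
Let resolvent_powers_lipschitz : exists2 L, 0 <= L & forall k u, rnorm u <= D ->
  1 - (u *: T) ^+ (2 ^ k)%N \is a GRing.unit /\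
  forall v, rnorm v <= D ->
    opnorm ((1 - (u *: T) ^+ (2 ^ k)%N)^-1 - (1 - (v *: T) ^+ (2 ^ k)%N)^-1)
      <= L * rnorm (u - v).
Proof.
have [K K0 hK] := resolvent_bound.
exists (K * opnorm T * K); first by rewrite !mulr_ge0 ?opnorm_ge0.
elim=> [u uD|k IH u uD].
  split => [|v vD]; rewrite !expr1; first exact: disc_unit.
  have -> : (1 - u *: T)^-1 - (1 - v *: T)^-1 =
      (u - v) *: ((1 - u *: T)^-1 * T * (1 - v *: T)^-1).
    rewrite invrB ?disc_unit// opprB [1 - _ + _]addrC addrA subrK -scalerBl.
    by rewrite -scalerAr -scalerAl.
  rewrite opnormZ mulrC ler_wpM2r ?rnorm_ge0// (le_trans (opnormM _ _))//.
  apply: ler_pM; rewrite ?opnorm_ge0 ?hK// (le_trans (opnormM _ _))//.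
  by rewrite ler_wpM2r ?opnorm_ge0 ?hK.
have [z zk z1] := root_of_minus1 k.
(* Passing from [w] to [z * w] stays in the disc and negates the power, so [1 + (w T)^(2^k)] is
   again an operator covered by the induction hypothesis. *)
have zD w : rnorm w <= D -> rnorm (z * w) <= D by rewrite rnormM z1 mul1r.
have zE w : (z * w *: T) ^+ (2 ^ k)%N = - (w *: T) ^+ (2 ^ k)%N.
  by rewrite !exprZn exprMn zk mulN1r scaleNr.
have step w : rnorm w <= D -> 1 - (w *: T) ^+ (2 ^ k.+1)%N \is a GRing.unit /\
    (1 - (w *: T) ^+ (2 ^ k.+1)%N)^-1 = (2^-1 : R)%:C *:
      ((1 - (w *: T) ^+ (2 ^ k)%N)^-1 + (1 - (z * w *: T) ^+ (2 ^ k)%N)^-1).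
  move=> wD; rewrite expnS mulnC exprM expr2 zE opprK; apply: inv_subr1_sqr.
    by have [] := IH w wD.
  by have [] := IH _ (zD w wD); rewrite zE opprK.
have [uu ->] := step u uD; split => // v vD; have [_ ->] := step v vD.
have h1 := (IH u uD).2 v vD; have h2 := (IH _ (zD u uD)).2 _ (zD v vD).
rewrite -scalerBr opprD addrACA opnormZR ger0_norm ?invr_ge0//.
rewrite -mulrBr rnormM z1 mul1r in h2.
apply: le_trans (ler_wpM2l _ (le_trans (opnormD _ _) (lerD h1 h2))) _ => //.
by move: (K * opnorm T * K * _) => a; clear h1 h2; lra.
Qed.

(** The exponent may depend on [t]; the threshold is the one required by
    [opnorm_le1_of_resolvent_close]. *)
Let power_small (t : R) := exists k, opnorm ((t%:C *: T) ^+ (2 ^ k)%N) <= 8^-1.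

(** Replacing [t] by [s] multiplies the power by [(s / t)^(2^(k + n))], which tends to [0] as [n]
    grows, while powers of an operator of norm at most [1] stay so. Thus the bound [1] at [t]
    becomes [1/8] at [s]. *)
Let power_small_lt (s t : R) : 0 <= s < t ->
  (exists k, opnorm ((t%:C *: T) ^+ (2 ^ k)%N) <= 1) -> power_small s.
Proof.
move=> /andP[s0 st] [k hk]; have t0 : 0 < t by lra.
have q1 : `|s / t| < 1.
  by rewrite ger0_norm ?divr_ge0// ?ltW// ltr_pdivrMr// mul1r.
have q0 : 0 <= s / t by rewrite divr_ge0// ltW.
have q1' : s / t <= 1 by rewrite ltW// -(ger0_norm q0).
have [n qn] : exists n, (s / t) ^+ n <= 8^-1.
  have /cvgr0_norm_lt/(_ 8^-1) := cvg_expr q1; case => // n _ h; exists n.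
  by have := h n (leqnn n); rewrite normrX (ger0_norm q0) => /ltW.
exists (k + n)%N.
have -> : s%:C%C = (s / t)%:C%C * t%:C%C by rewrite -rmorphM/= divfK// gt_eqF.
rewrite -scalerA exprZn -rmorphXn/= opnormZR ger0_norm ?exprn_ge0//.
rewrite -[leRHS]mulr1; apply: ler_pM; rewrite ?exprn_ge0 ?opnorm_ge0//.
  rewrite (le_trans _ qn)// ler_wiXn2l//.
  by rewrite (leq_trans (ltnW (ltn_expl n (ltnSn 1))))// leq_exp2l// leq_addl.
rewrite expnD exprM (le_trans (opnormX_le _ _))// exprn_ile1 ?opnorm_ge0//.
Qed.

(* By equicontinuity, smallness of some [(t T)^(2^k)] propagates from [0] to
   every [t < D] in steps of fixed length. *)
Let power_small_all (t : R) : 0 <= t < D -> power_small t.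
Proof.
have [L L0 hL] := resolvent_powers_lipschitz.
(* Chosen so that [L * d <= 1/4], the distance between inverses allowed by
   [opnorm_le1_of_resolvent_close]. *)
pose d := (4 * (L + 1))^-1.
have d0 : 0 < d by rewrite invr_gt0 mulr_gt0// ltr_wpDl.
have Ld : L * d <= 4^-1.
  by rewrite /d invfM mulrCA ler_piMr// ler_pdivrMr ?mul1r ?lerDl// ltr_wpDl.
have step (s s' : R) : 0 <= s <= D -> 0 <= s' <= D -> `|s' - s| <= d ->
    power_small s -> exists k, opnorm ((s'%:C *: T) ^+ (2 ^ k)%N) <= 1.
  move=> /andP[s0 sD] /andP[s'0 s'D] ss' [k xk]; exists k.
  have sD' : rnorm s%:C <= D by rewrite rnormC ger0_norm.
  have s'D' : rnorm s'%:C <= D by rewrite rnormC ger0_norm.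
  have [ux _] := hL k _ sD'; have [uy /(_ _ sD') hyx] := hL k _ s'D'.
  rewrite -rmorphB/= rnormC opnormBC in hyx.
  set x := (s%:C *: T) ^+ _ in xk ux hyx;
    set y := (s'%:C *: T) ^+ _ in uy hyx *.
  apply: (opnorm_le1_of_resolvent_close ux xk uy).
  by rewrite (le_trans hyx)// (le_trans _ Ld)// ler_wpM2l.
have march j : forall s, 0 <= s < D -> s <= j%:R * (d / 2) -> power_small s.
  elim: j => [|j IH] s /andP[s0 sD] sj.
    have -> : s = 0 by apply/le_anti; rewrite s0 (le_trans sj)// mul0r.
    by exists 0%N; rewrite scale0r expr1 opnorm0.
  (* From [s1], half a step below [s], a full step reaches [s2 > s], where some power has norm at
     most [1]; returning from [s2] to [s] restores the threshold [1/8]. *)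
  pose s1 := Num.max 0 (s - d / 2).
  have s10 : 0 <= s1 by rewrite le_max lexx.
  have s1s : s1 <= s by rewrite ge_max s0/=; lra.
  have s1s' : s - d / 2 <= s1 by rewrite le_max lexx orbT.
  have h1 : power_small s1.
    apply: IH; first by rewrite s10 (le_lt_trans s1s).
    rewrite ge_max mulr_ge0//=; last by rewrite divr_ge0// ltW.
    by move: sj; rewrite -natr1 mulrDl mul1r; lra.
  pose s2 := Num.min D (s1 + d).
  have s2D : s2 <= D by rewrite ge_min lexx.
  have s2s1 : s2 <= s1 + d by rewrite ge_min lexx orbT.
  have ss2 : s < s2 by rewrite lt_min sD/=; lra.
  apply: (@power_small_lt _ s2); first by rewrite s0.
  apply: step h1; rewrite ?s10 ?s2D ?(le_trans s1s) ?(le_trans s0)//; try lra.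
  by rewrite ger0_norm; lra.
move=> t0D; apply: (march (Num.trunc (t / (d / 2))).+1 t t0D).
by rewrite -ler_pdivrMr ?divr_gt0// ltW// truncnS_gt.
Qed.

Lemma opnorm_power_le_of_disc (s : R) : D^-1 < s ->
  exists2 n, (0 < n)%N & opnorm (T ^+ n) <= s ^+ n.
Proof.
move=> Ds; have s0 : 0 < s by rewrite (lt_trans _ Ds)// invr_gt0.
have [|k hk] := @power_small_all s^-1.
  by rewrite invr_ge0 ltW//= -[D]invrK ltf_pV2// posrE invr_gt0.
exists (2 ^ k)%N; first by rewrite expn_gt0.
move: hk; rewrite exprZn -rmorphXn/= opnormZR ger0_norm; last first.
  by rewrite exprn_ge0// invr_ge0 ltW.
rewrite exprVn ler_pdivrMl ?exprn_gt0// => /le_trans; apply.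
by rewrite ler_piMr ?exprn_ge0 ?(ltW s0)// invf_le1 ?ler1n.
Qed.

End fixed_operator.

Lemma opnorm_power_le T (s : R) : spectral_radius T < s ->
  exists2 n, (0 < n)%N & opnorm (T ^+ n) <= s ^+ n.
Proof.
move=> Ts; have r0 := spectral_radius_ge0 T.
set r := spectral_radius T in Ts r0.
have m0 : 0 < (r + s) / 2 by lra.
(* The midpoint [D^-1 = (r + s) / 2] is positive even when [r = 0], lies strictly above the spectral
   radius and strictly below [s]. *)
apply: (@opnorm_power_le_of_disc T ((r + s) / 2)^-1).
- by rewrite invr_gt0.
- by move=> z; rewrite invrK => h /spectral_radius_ge; rewrite -/r; lra.
- by rewrite invrK; lra.
Qed.

End power_bound.

(** * Exponential and renorming *)

Section exponential.
Context {R : realType} {H : nzHilbertType R}.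
Implicit Types (S T A B P : bop H) (p q : {poly R}) (s t : R).

Definition exp_poly (n : nat) : {poly R} := \sum_(k < n) (k`!%:R)^-1 *: 'X^k.

Lemma horner_exp_poly n t : (exp_poly n).[t] = series (exp_coeff t) n.
Proof.
rewrite /exp_poly horner_sum seriesEord; apply: eq_bigr => k _.
by rewrite hornerZ hornerXn mulrC.
Qed.

Lemma hornerR_exp_poly A n :
  hornerR A (exp_poly n) = series (fun n => (n`!%:R : R[i])^-1 *: A ^+ n) n.
Proof.
rewrite seriesEord /exp_poly.
apply: (big_ind2 (fun p B => hornerR A p = B)) => [|p B q C <- <-|k _].
- by rewrite -polyC0 hornerRC scale0r.
- exact: hornerRD.
- by rewrite hornerRZ hornerRXn fmorphV/= rmorph_nat.
Qed.

Lemma series_exp_coeff_cvg t (e : R) : 0 < e ->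
  exists N, forall n, (N <= n)%N -> `|series (exp_coeff t) n - expR t| <= e.
Proof.
move=> e0; have /cvgrPdist_le/(_ e e0)[N _ hN] := is_cvg_series_exp_coeff t.
by exists N => n /hN; rewrite distrC.
Qed.

(** The increments of the series at [t] are dominated by those at [M], so [n] does not depend on
    [t]. Of the [3 * e], one [e] separates a late partial sum at [t] from its limit, and two bound
    the increment at [M]. *)
Lemma exp_poly_tail (M t e : R) : 0 <= M -> `|t| <= M -> 0 < e ->
  forall n, `|series (exp_coeff M) n - expR M| <= e ->
  `|(exp_poly n).[t] - expR t| <= 3 * e.
Proof.
move=> M0 tM e0 n hn; rewrite horner_exp_poly.
have [N1 h1] := series_exp_coeff_cvg t e0;
  have [N2 h2] := series_exp_coeff_cvg M e0.
pose m := maxn n (maxn N1 N2).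
have nm : (n <= m)%N by exact: leq_maxl.
have {}h1 := h1 m (leq_trans (leq_maxl _ _) (leq_maxr _ _)).
have {}h2 := h2 m (leq_trans (leq_maxr _ _) (leq_maxr _ _)).
have diff x : series (exp_coeff x) m - series (exp_coeff x) n =
    \sum_(n <= k < m) exp_coeff x k by rewrite sub_series nm.
have h3 : `|series (exp_coeff t) m - series (exp_coeff t) n| <=
    series (exp_coeff M) m - series (exp_coeff M) n.
  rewrite !diff (le_trans (ler_norm_sum _ _ _))// ler_sum// => k _.
  rewrite /exp_coeff normrM normrX (ger0_norm (_ : 0 <= _^-1)) ?invr_ge0//.
  by rewrite ler_wpM2r ?invr_ge0// lerXn2r.
move: h1 h2 h3 hn; rewrite !ler_norml => /andP[a1 a2] /andP[b1 b2] /andP[c1 c2]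
  /andP[d1 d2].
by apply/andP; split; lra.
Qed.

Lemma self_adjoint_spectrum_norm S t : spectrum S t%:C -> `|t| <= opnorm S.
Proof. by move=> /spectrum_le_opnorm; rewrite rnormC. Qed.

(** The partial sums defining [op_exp A] are polynomials in [A] that converge to [expR] uniformly on
    the spectrum, which lies in [[-|A|, |A|]]. *)
Lemma op_exp_fc A : self_adjoint A ->
  is_functional_calculus (@expR R) A (op_exp A).
Proof.
move=> hA.
have tail (e : R) : 0 < e -> exists N, forall n, (N <= n)%N ->
    forall t, spectrum A t%:C -> `|(exp_poly n).[t] - expR t| <= e.
  move=> e0; have e30 : 0 < e / 3 by rewrite divr_gt0.
  have [N hN] := series_exp_coeff_cvg (opnorm A) e30.
  exists N => n Nn t /self_adjoint_spectrum_norm tA.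
  have := exp_poly_tail (opnorm_ge0 A) tA e30 (hN n Nn).
  by rewrite mulrCA divff// mulr1.
have [B AB] : exists B, is_functional_calculus (@expR R) A B.
  apply: fc_exists => // e /tail[N hN]; exists (exp_poly N); exact: hN.
suff -> : op_exp A = B by [].
apply: cvg_lim; first exact: norm_hausdorff.
apply/cvgrPdist_lt => e e0.
have e'0 : 0 < complex.Re e by rewrite -ltcR RRe_real// gtr0_real.
have e'20 : 0 < complex.Re e / 2 by rewrite divr_gt0.
have [N hN] := tail _ e'20; exists N => // n /= Nn.
rewrite -hornerR_exp_poly distrC -rnormE -[e]RRe_real ?gtr0_real// ltcR.
rewrite (@le_lt_trans _ _ (complex.Re e / 2))//; last by lra.
exact: (fc_norm_le hA (hN n Nn) (fc_sub (fc_hornerR A _) AB)).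
Qed.

Lemma op_expN_fc A : self_adjoint A ->
  is_functional_calculus (fun t => expR (- t)) A (op_exp (- A)).
Proof.
move=> hA; have hNA : self_adjoint (- A) by rewrite /self_adjoint adjointN hA.
have -> : (fun t => expR (- t)) = (fun t => expR (- 'X : {poly R}).[t]).
  by apply/funext => t; rewrite hornerN hornerX.
apply: fc_comp_hornerR;
  rewrite -[- 'X]scaleN1r hornerRZ hornerRX rmorphN1 scaleN1r.
exact: op_exp_fc.
Qed.

Lemma op_exp_unit A : self_adjoint A ->
  op_exp A \is a GRing.unit /\ (op_exp A)^-1 = op_exp (- A).
Proof.
move=> hA; have fA := op_exp_fc hA; have fNA := op_expN_fc hA.
have f1 : is_functional_calculus (fun=> 1) A 1.
  have := fc_hornerR A 1%:P; rewrite hornerRC scale1r.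
  by apply: fc_ext => t _; rewrite hornerC.
have e1 : op_exp A * op_exp (- A) = 1.
  apply: (fc_uniq hA _ f1); apply: (fc_ext _ (fc_mul hA fA fNA)) => t _.
  by rewrite expRxMexpNx_1.
have e2 : op_exp (- A) * op_exp A = 1.
  apply: (fc_uniq hA _ f1); apply: (fc_ext _ (fc_mul hA fNA fA)) => t _.
  by rewrite mulrC expRxMexpNx_1.
have uA : op_exp A \is a GRing.unit by apply/unitrP; exists (op_exp (- A)).
by split => //; apply: (mulrI uA); rewrite mulrV.
Qed.

Lemma norm_expRB1_le t : `|expR t - 1| <= expR `|t| - 1.
Proof.
have [t0|t0] := leP 0 t.
  by rewrite (ger0_norm t0) ger0_norm// subr_ge0 -expR0 ler_expR.
rewrite (ltr0_norm t0) ler0_norm; last by rewrite subr_le0 -expR0 ler_expR ltW.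
by have := expR_ge1Dx t; have := expR_ge1Dx (- t); lra.
Qed.

Lemma exp_log_approximable (M d : R) : 0 < d ->
  exists q, forall t, 1 <= t <= M -> `|expR q.[t] * expR q.[t] - t| <= d.
Proof.
move=> d0; have M0 : 0 < `|M| + 1 by rewrite ltr_wpDl.
have dM0 : 0 < d / (`|M| + 1) by rewrite divr_gt0.
(* This precision for [ln t] gives a relative error at most [d / (|M| + 1)] after exponentiation,
   hence an absolute error at most [d] for [t <= M]. *)
have e0 : 0 < ln (1 + d / (`|M| + 1)) by rewrite ln_gt0// ltrDl.
have [p hp] := ln_approximable M e0;
  exists (2^-1 *: p) => t /[dup] /hp pt /andP[t1 tM].
have t0 : 0 < t by lra.
rewrite -expRD hornerZ -mulrDl (_ : 2^-1 + 2^-1 = 1) ?mul1r; last by lra.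
have -> : expR p.[t] - t = t * (expR (p.[t] - ln t) - 1).
  by rewrite expRB lnK// mulrBr mulr1 mulrC divfK// gt_eqF.
rewrite normrM (gtr0_norm t0) (@le_trans _ _ ((`|M| + 1) * (d / (`|M| + 1))))//.
  apply: ler_pM => //; first exact: ltW.
    by rewrite (le_trans tM)// (le_trans (ler_norm _))// lerDl.
  rewrite (le_trans (norm_expRB1_le _))// lerBlDl.
  by rewrite (le_trans _ (_ : expR (ln (1 + d / (`|M| + 1))) <= _))//
    ?ler_expR// lnK// posrE addr_gt0.
by rewrite mulrC divfK// gt_eqF.
Qed.

(* In the norm |x|_P^2 = <P x, x>, with P = sum_(k < n) s^(-2k) (T^k)^* T^k,
   the sum for T x is s^2 times the one for x up to its two end terms. *)
Lemma renorming T s : spectral_radius T < s -> exists P, [/\ self_adjoint P,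
  forall x, rnorm x ^+ 2 <= rdot (P x) x &
  forall x, rdot (P (T x)) (T x) <= s ^+ 2 * rdot (P x) x].
Proof.
move=> Ts; have s0 : 0 < s by rewrite (le_lt_trans _ Ts)// spectral_radius_ge0.
have [[//|n] _ Tn] := opnorm_power_le Ts.
pose w k := (s ^+ 2) ^- k.
have w0 k : 0 <= w k by rewrite invr_ge0 exprn_ge0// sqr_ge0.
pose P := \sum_(k < n.+1) (w k)%:C *: (adjoint (T ^+ k) * T ^+ k).
have PE x : rdot (P x) x = \sum_(k < n.+1) w k * rnorm ((T ^+ k) x) ^+ 2.
  rewrite /P; apply: (big_ind2 (fun (B : bop H) (r : R) => rdot (B x) x = r))
    => [|B r C r' <- <-|k _].
  - by rewrite /rdot inner0l.
  - by rewrite -rdotDl.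
  - rewrite -[bop_fun _ x]/((w k)%:C *: (adjoint (T ^+ k) ((T ^+ k) x))).
    by rewrite rdotZl rdot_adjoint adjointK rdotxx.
exists P; split.
- rewrite /P; apply: big_ind => [|B C hB hC|k _].
  + by rewrite /self_adjoint -(scale0r (1 : bop H)) adjointZ adjoint1 conjc0.
  + by rewrite /self_adjoint adjointD hB hC.
  + by rewrite /self_adjoint adjointZ conjc_real adjointM adjointK.
- move=> x; rewrite PE big_ord_recl /w expr0 invr1 mul1r expr0 lerDl.
  apply: sumr_ge0 => k _; apply: mulr_ge0 (sqr_ge0 _); exact: (w0 k.+1).
- move=> x; rewrite !PE [X in _ <= _ * X]big_ord_recl mulrDr
  [leLHS]big_ord_recr /=.
  have -> : \sum_(i < n) w i * rnorm ((T ^+ i) (T x)) ^+ 2 =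
      s ^+ 2 * \sum_(i < n) w (lift ord0 i) * rnorm ((T ^+ lift ord0 i) x) ^+ 2.
    rewrite mulr_sumr; apply: eq_bigr => i _; rewrite lift0 (mulrA (s ^+ 2)).
    rewrite (exprSr T) -[(T ^+ i * T) x]/((T ^+ i) (T x)); congr (_ * _).
    by rewrite /w (exprS (s ^+ 2)) invfM mulrA divff ?mul1r// sqrf_eq0 gt_eqF.
  (* Only the end terms remain: [w n * |T^(n+1) x|^2 <= s^2 |x|^2], which is the bound on
     [T ^+ n.+1]. *)
  rewrite addrC lerD2r -[(T ^+ n) (T x)]/((T ^+ n * T) x) -(exprSr T).
  rewrite /w !expr0 invr1 mul1r.
  rewrite ler_pdivrMl ?exprn_gt0// (mulrA _ (s ^+ 2)) -(exprSr (s ^+ 2)) -exprM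
    mulnC exprM -exprMn.
  rewrite ler_sqr ?nnegrE ?mulr_ge0 ?rnorm_ge0 ?exprn_ge0 ?(ltW s0)//.
  by rewrite (le_trans (rnorm_opnorm _ _))// ler_wpM2r ?rnorm_ge0.
Qed.

(* Instead of [ln P / 2], [A] is a polynomial in [P] such that [e^(2A)] is close
   to [P]; the loss is absorbed by the gap between [spectral_radius T] and [s].
     *)
Lemma exp_conj_bound T s : spectral_radius T < s ->
  exists2 A, self_adjoint A & opnorm (op_exp A * T * op_exp (- A)) <= s.
Proof.
move=> Ts; have r0 := spectral_radius_ge0 T;
  set r := spectral_radius T in Ts r0.
pose s' := (r + s) / 2.
have rs' : r < s' by rewrite /s'; lra.
have s's : s' < s by rewrite /s'; lra.
have s'0 : 0 < s' by lra.
have [P [hP P1 PT]] := renorming rs'.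
have ss : s' ^+ 2 < s ^+ 2 by rewrite ltr_sqr ?nnegrE ?ltW// (lt_trans s'0).
have s'20 : 0 < s' ^+ 2 by rewrite exprn_gt0.
(* The solution of [s'^2 (1 + d) = s^2 (1 - d)]: once [(1 - d) P <= e^(2A) <= (1 + d) P], the factor
   [s'] for [P] becomes the factor [s] for [e^(2A)]. *)
pose d := (s ^+ 2 - s' ^+ 2) / (s ^+ 2 + s' ^+ 2).
have dd0 : 0 < s ^+ 2 + s' ^+ 2 by rewrite addr_gt0// (lt_trans s'20).
have d0 : 0 < d by rewrite divr_gt0// subr_gt0.
have d1 : d < 1 by rewrite ltr_pdivrMr// mul1r; lra.
have dE : s' ^+ 2 * (1 + d) = s ^+ 2 * (1 - d).
  by rewrite /d; field; rewrite gt_eqF.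
have [q hq] := exp_log_approximable (opnorm P) d0.
pose A := hornerR P q; have hA : self_adjoint A by exact: self_adjoint_hornerR.
exists A => //; have [uA AN] := op_exp_unit hA; have fA := op_exp_fc hA.
have hE : self_adjoint (op_exp A) by exact: fc_self_adjoint fA.
set E := op_exp A in uA AN fA hE *.
have EP : opnorm (E * E - P) <= d.
  have fP := fc_hornerR P 'X; rewrite hornerRX in fP.
  apply: (fc_norm_le hP _ (fc_sub (fc_comp_hornerR (fc_mul hA fA fA)) fP)) => t
    Pt.
  rewrite hornerX; apply: hq; apply/andP; split.
    by apply: (spectrum_ge hP _ Pt) => x; rewrite mul1r.
  by rewrite (le_trans (ler_norm _))// self_adjoint_spectrum_norm.
(* [P >= 1] turns the absolute error [d] in norm into an error relative to [P]. *)
have Ex x : `|rnorm (E x) ^+ 2 - rdot (P x) x| <= d * rdot (P x) x.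
  have -> : rnorm (E x) ^+ 2 - rdot (P x) x = rdot ((E * E - P) x) x.
    by rewrite bopBE rdotBl -[(E * E) x]/(E (E x)) (self_adjoint_rdot _ _ hE)
      rdotxx.
  rewrite (le_trans (norm_rdot_le _ _))// (le_trans _ (ler_wpM2l (ltW d0) (P1
    x)))//.
  rewrite expr2 mulrA ler_wpM2r ?rnorm_ge0// (le_trans (rnorm_opnorm _ _))//.
  by rewrite ler_wpM2r ?rnorm_ge0.
have s0 : 0 <= s by rewrite ltW// (lt_trans s'0).
apply: opnorm_le => // y; rewrite -AN.
pose x := E^-1 y; have yE : y = E x by rewrite -[LHS]/((1 : bop H) y) -(mulrV
  uA).
rewrite -[(E * T * E^-1) y]/(E (T x)) yE.
rewrite -ler_sqr ?nnegrE ?mulr_ge0 ?rnorm_ge0// exprMn.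
have h1 := Ex x; have h2 := Ex (T x); rewrite !ler_distl in h1 h2.
have /andP[h1' _] := h1; have /andP[_ h2'] := h2.
have h3 : (1 + d) * rdot (P (T x)) (T x) <= (1 + d) * (s' ^+ 2 * rdot (P x) x).
  by rewrite ler_wpM2l// addr_ge0// ltW.
have h4 : s ^+ 2 * ((1 - d) * rdot (P x) x) <= s ^+ 2 * rnorm (E x) ^+ 2.
  by rewrite ler_wpM2l ?sqr_ge0// mulrBl mul1r.
rewrite mulrA -dE mulrAC mulrC in h4.
apply: le_trans h4; rewrite (le_trans _ h3)//.
by rewrite mulrDl mul1r.
Qed.

End exponential.

Lemma inf_eq_of_lb (R : realType) (E : set R) (r : R) :
  (forall x, E x -> r <= x) ->
  (forall s, r < s -> exists2 x, E x & x <= s) -> r = inf E.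
Proof.
move=> rE Er.
have E0 : E !=set0 by have [|x Ex _] := Er (r + 1); [rewrite ltrDl|exists x].
apply/le_anti; rewrite lb_le_inf//=; apply/ler_addgt0Pr => e e0.
have [|x Ex xr] := Er (r + e); first by rewrite ltrDl.
by rewrite (le_trans _ xr)//; apply: ge_inf => //; exists r.
Qed.

Unset Implicit Arguments.

Theorem theorem2p1 (R : realType) (H : nzHilbertType R) (lambda : R)
    (hlambda : 0 <= lambda <= 1) (T : bop H) :
  spectral_radius T =
    inf [set opnorm (aluthge lambda (X * T * X^-1)) | X in
           [set X : bop H | X \is a GRing.unit]] /\
  spectral_radius T =
    inf [set opnorm (aluthge lambda (op_exp A * T * op_exp (- A))) | A in
           [set A : bop H | self_adjoint A]].
Proof.
have lb (X : bop H) : X \is a GRing.unit ->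
    spectral_radius T <= opnorm (aluthge lambda (X * T * X^-1)).
  move=> uX; rewrite -(spectral_radius_conj T uX).
  exact: spectral_radius_le_opnorm_aluthge.
split; apply: inf_eq_of_lb.
- by move=> _ [X /= uX <-]; exact: lb.
- move=> s /exp_conj_bound[A hA As]; have [uA AN] := op_exp_unit hA.
  exists (opnorm (aluthge lambda (op_exp A * T * (op_exp A)^-1))).
    by exists (op_exp A).
  by rewrite AN (le_trans (opnorm_aluthge_le _ hlambda)).
(* Conjugation by [op_exp A] is an instance of conjugation by a unit, so the lower bound [lb]
   applies. *)
- move=> _ [A /= hA <-]; have [uA <-] := op_exp_unit hA; exact: lb.
- move=> s /exp_conj_bound[A hA As].
  exists (opnorm (aluthge lambda (op_exp A * T * op_exp (- A))));
    first by exists A.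
  by rewrite (le_trans (opnorm_aluthge_le _ hlambda)).
Qed.
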